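(* Let $\mathcal{V}$ be any variety of modal algebras that is closed under canonical extensions and not weakly transitive (i.e. for every $n\in\mathbb{N}$, $\mathcal{V}\not\models\boxdot^{n+1}x\approx\boxdot^n x$, where $\boxdot x:=\Box x\wedge x$). Then $\mathcal{V}$ is not coherent, $\mathcal{V}$ does not admit right uniform deductive interpolation, and the first-order theory of $\mathcal{V}$ does not have a model completion.
   Context: A modal algebra is a Boolean algebra $\langle A,\wedge,\vee,\neg,0,1\rangle$ with a unary operation $\Box$ satisfying $\Box 1=1$ and $\Box(x\wedge y)=\Box x\wedge\Box y$. $\boxdot^0x=x$, $\boxdot^{k+1}x=\boxdot(\boxdot^kx)$. Canonical extensions. A completion of a poset $P$ is a complete lattice $C$ with an order embedding of $P$ into $C$ preserving all existing finite meets and joins; $P$ is identified with its image. An element of $C$ is open (resp. closed) if it is a join (resp. meet) in $C$ of a nonempty subset of $P$; $O$ and $K$ denote the sets of open and closed elements. The completion is dense if every element of $C$ is both a join of closed elements and a meet of open elements; it is compact if for all nonempty $A\subseteq K$, $B\subseteq O$: $\bigwedge A\le\bigvee B$ iff $\bigwedge A_0\le\bigvee B_0$ for some finite nonempty $A_0\subseteq A$, $B_0\subseteq B$. A dense compact completion is called the canonical extension $P^\sigma$ of $P$ (unique up to isomorphism fixing $P$). For a modal algebra $\mathbf{A}$, $\mathbf{A}^\sigma$ is the canonical extension of its Boolean reduct (a Boolean algebra) with $$\Box^\pi(x)=\bigwedge\bigl\{\bigvee\{\Box a\mid a\in A,\ p\le a\le q\}\mid p\in K,\ q\in O,\ p\le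 x\le q\bigr\}.$$ $\mathcal{V}$ is closed under canonical extensions if $\mathbf{A}\in\mathcal{V}$ implies $\mathbf{A}^\sigma\in\mathcal{V}$. $\mathcal{V}$ is coherent if every finitely generated subalgebra of a finitely presented member of $\mathcal{V}$ is finitely presented (finitely presented: isomorphic to a quotient of a finitely generated free algebra of $\mathcal{V}$ by a finitely generated congruence). $\Sigma\models_{\mathcal{V}}\varepsilon$ means that every assignment of the variables into any member of $\mathcal{V}$ satisfying all equations in $\Sigma$ satisfies $\varepsilon$. $\mathcal{V}$ admits right uniform deductive interpolation if for any finite disjoint sets of variables $\overline{x},\overline{y}$ and finite set $\Sigma$ of equations in variables $\overline{x},\overline{y}$, there is a finite set $\Pi$ of equations in variables $\overline{y}$ such that for every equation $\varepsilon$ whose variables lie in $\overline{y}$ and a set $\overline{z}$ disjoint from $\overline{x},\overline{y}$: $\Sigma\models_{\mathcal{V}}\varepsilon\iff\Pi\models_{\mathcal{V}}\varepsilon$. A model completion of a theory $T$ is a theory $T^*\supseteq T$ in the same language such that every model of $T$ embeds into a model of $T^*$ and, for every model $M$ of $T$, $T^*$ together with the quantifier-free diagram of $M$ is a complete theory. *)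

(* Defs.v *)
From mathcomp Require Import all_boot.
From mathcomp Require Import boolp classical_sets functions cardinality.

Set Implicit Arguments.
Unset Strict Implicit.
Unset Printing Implicit Defensive.

Local Open Scope classical_set_scope.

(* Algebras and first-order structures of the signature of modal algebras;
   no axioms are imposed here. *)
Record algebra := Algebra {
  carrier :> Type;
  meet : carrier -> carrier -> carrier;
  join : carrier -> carrier -> carrier;
  neg : carrier -> carrier;
  bot : carrier;
  top : carrier;
  box : carrier -> carrier }.

Arguments bot {_}.
Arguments top {_}.

Record boolean_algebra (A : algebra) : Prop := BooleanAlgebra {
  meet_assoc : associative (@meet A);
  join_assoc : associative (@join A);
  meet_comm : commutative (@meet A);
  join_comm : commutative (@join A);
  meet_absorb : forall x y : A, meet x (join x y) = x;
  join_absorb : forall x y : A, join x (meet x y) = x;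
  meet_distr : left_distributive (@meet A) (@join A);
  meet_top : right_id top (@meet A);
  join_bot : right_id bot (@join A);
  meet_neg : right_inverse bot (@neg A) (@meet A);
  join_neg : right_inverse top (@neg A) (@join A) }.

Record modal_algebra (A : algebra) : Prop := ModalAlgebra {
  modal_boolean : boolean_algebra A;
  box_top : box top = top :> A;
  box_meet : {morph @box A : x y / meet x y} }.

Definition ale (A : algebra) (x y : A) : Prop := meet x y = x.

Inductive term (X : Type) : Type :=
| Var of X
| TMeet of term X & term X
| TJoin of term X & term X
| TNeg of term X
| TBot
| TTop
| TBox of term X.

Arguments TBot {X}.
Arguments TTop {X}.

Fixpoint eval (A : algebra) (X : Type) (v : X -> A) (t : term X) : A :=
  match t with
  | Var x => v x
  | TMeet s u => meet (eval v s) (eval v u)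
  | TJoin s u => join (eval v s) (eval v u)
  | TNeg s => neg (eval v s)
  | TBot => bot
  | TTop => top
  | TBox s => box (eval v s)
  end.

Fixpoint tvars (X : Type) (t : term X) : set X :=
  match t with
  | Var x => [set x]
  | TMeet s u | TJoin s u => tvars s `|` tvars u
  | TNeg s | TBox s => tvars s
  | TBot | TTop => set0
  end.

Definition equation := (term nat * term nat)%type.

Definition eq_vars (e : equation) : set nat := tvars e.1 `|` tvars e.2.

Definition eq_holds (A : algebra) (v : nat -> A) (e : equation) : Prop :=
  eval v e.1 = eval v e.2.

Definition valid (A : algebra) (e : equation) : Prop :=
  forall v : nat -> A, eq_holds v e.

(* Classes of algebras are typed [algebra -> Prop] because [set algebra] would
   force carriers to live strictly below the universe of [set], excluding power
   sets as carriers. *)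
Definition variety (V : algebra -> Prop) : Prop :=
  exists E : set equation, forall A, V A <-> forall e, E e -> valid A e.

Definition consequence (V : algebra -> Prop) (S : set equation) (e : equation) :
    Prop :=
  forall A : algebra, V A -> forall v : nat -> A,
    (forall d, S d -> eq_holds v d) -> eq_holds v e.

Definition boxdot_term (n : nat) : term nat :=
  iter n (fun t => TMeet (TBox t) t) (Var 0).

Definition weakly_transitive (V : algebra -> Prop) : Prop :=
  exists n : nat, forall A : algebra, V A ->
    valid A (boxdot_term n.+1, boxdot_term n).

Section OrderNotions.
Variables (T : Type) (le : T -> T -> Prop).

Definition is_lub (S : set T) (x : T) : Prop :=
  (forall y, S y -> le y x) /\
  (forall z, (forall y, S y -> le y z) -> le x z).

Definition is_glb (S : set T) (x : T) : Prop :=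
  (forall y, S y -> le x y) /\
  (forall z, (forall y, S y -> le z y) -> le z x).

Definition complete_lattice : Prop :=
  [/\ forall x, le x x,
      forall x y, le x y -> le y x -> x = y,
      forall x y z, le x y -> le y z -> le x z &
      forall S : set T,
        (exists x, is_lub S x) /\ (exists x, is_glb S x)].

End OrderNotions.

Section Completions.
Variables (P C : Type) (leP : P -> P -> Prop) (leC : C -> C -> Prop).
Variable i : P -> C.

Definition completion : Prop :=
  [/\ complete_lattice leC,
      forall p q, leP p q <-> leC (i p) (i q),
      forall (S : set P) p, finite_set S ->
        is_glb leP S p -> is_glb leC (i @` S) (i p) &
      forall (S : set P) p, finite_set S ->
        is_lub leP S p -> is_lub leC (i @` S) (i p)].

Definition open_elt : set C :=
  [set x | exists S : set P, S !=set0 /\ is_lub leC (i @` S) x].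

Definition closed_elt : set C :=
  [set x | exists S : set P, S !=set0 /\ is_glb leC (i @` S) x].

Definition dense_completion : Prop :=
  forall x : C,
    (exists S : set C, S `<=` closed_elt /\ is_lub leC S x) /\
    (exists S : set C, S `<=` open_elt /\ is_glb leC S x).

(* [a] and [b] are the meet and the join that exist in the complete lattice
   [C]; likewise [a0] and [b0]. *)
Definition compact_completion : Prop :=
  forall (A B : set C) (a b : C),
    A !=set0 -> B !=set0 -> A `<=` closed_elt -> B `<=` open_elt ->
    is_glb leC A a -> is_lub leC B b ->
    (leC a b <->
     exists (A0 B0 : set C) (a0 b0 : C),
       [/\ finite_set A0 /\ finite_set B0,
           A0 !=set0 /\ B0 !=set0,
           A0 `<=` A /\ B0 `<=` B,
           is_glb leC A0 a0 /\ is_lub leC B0 b0 &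
           leC a0 b0]).

Definition canonical_completion : Prop :=
  [/\ completion, dense_completion & compact_completion].

End Completions.

(* [box_pi i x y] says that [y] is the value at [x] of the pi-extension of the
   operation [box] of [A]. *)
Definition box_pi (A C : algebra) (i : A -> C) (x y : C) : Prop :=
  is_glb (@ale C)
    [set z | exists p q : C,
       [/\ closed_elt (@ale C) i p, open_elt (@ale C) i q,
           ale p x /\ ale x q &
           is_lub (@ale C)
             [set w | exists a : A, [/\ ale p (i a), ale (i a) q &
                                        w = i (box a)]] z]]
    y.

(* Canonical extensions are unique up to isomorphism, so a copy of the
   canonical extension of [A] is any algebra [C] with these properties. *)
Definition canonical_extension (A C : algebra) (i : A -> C) : Prop :=
  [/\ boolean_algebra C,
      canonical_completion (@ale A) (@ale C) i &
      forall x : C, box_pi i x (box x)].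

Definition closed_under_canonical_extensions (V : algebra -> Prop) : Prop :=
  forall (A C : algebra) (i : A -> C),
    V A -> canonical_extension i -> V C.

Record homomorphism (A B : algebra) (f : A -> B) : Prop := Homomorphism {
  hom_meet : forall x y, f (meet x y) = meet (f x) (f y);
  hom_join : forall x y, f (join x y) = join (f x) (f y);
  hom_neg : forall x, f (neg x) = neg (f x);
  hom_bot : f bot = bot;
  hom_top : f top = top;
  hom_box : forall x, f (box x) = box (f x) }.

Definition isomorphic (A B : algebra) : Prop :=
  exists f : A -> B, homomorphism f /\ bijective f.

Definition embeds (A B : algebra) : Prop :=
  exists f : A -> B, homomorphism f /\ injective f.

Record subuniverse (A : algebra) (S : set A) : Prop := Subuniverse {
  sub_meet : forall x y, S x -> S y -> S (meet x y);
  sub_join : forall x y, S x -> S y -> S (join x y);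
  sub_neg : forall x, S x -> S (neg x);
  sub_bot : S bot;
  sub_top : S top;
  sub_box : forall x, S x -> S (box x) }.

Definition subalgebra (A : algebra) (S : set A) (hS : subuniverse S) :
    algebra :=
  @Algebra {x : A | S x}
    (fun x y => exist S _ (sub_meet hS (proj2_sig x) (proj2_sig y)))
    (fun x y => exist S _ (sub_join hS (proj2_sig x) (proj2_sig y)))
    (fun x => exist S _ (sub_neg hS (proj2_sig x)))
    (exist S _ (sub_bot hS))
    (exist S _ (sub_top hS))
    (fun x => exist S _ (sub_box hS (proj2_sig x))).

Definition generated (A : algebra) (G : set A) : set A :=
  [set x | forall S : set A, subuniverse S -> G `<=` S -> S x].

Lemma generated_subuniverse (A : algebra) (G : set A) :
  subuniverse (generated G).
Proof.
split.
- move=> x y hx hy S hS GS.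
  exact: (sub_meet hS (hx S hS GS) (hy S hS GS)).
- move=> x y hx hy S hS GS.
  exact: (sub_join hS (hx S hS GS) (hy S hS GS)).
- by move=> x hx S hS GS; exact: (sub_neg hS (hx S hS GS)).
- by move=> S hS GS; exact: sub_bot hS.
- by move=> S hS GS; exact: sub_top hS.
- by move=> x hx S hS GS; exact: (sub_box hS (hx S hS GS)).
Qed.

Definition generated_subalgebra (A : algebra) (G : set A) : algebra :=
  subalgebra (generated_subuniverse G).

Record congruence (A : algebra) (R : A -> A -> Prop) : Prop := Congruence {
  cong_refl : forall x, R x x;
  cong_sym : forall x y, R x y -> R y x;
  cong_trans : forall x y z, R x y -> R y z -> R x z;
  cong_meet : forall x x' y y', R x x' -> R y y' ->
    R (meet x y) (meet x' y');
  cong_join : forall x x' y y', R x x' -> R y y' ->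
    R (join x y) (join x' y');
  cong_neg : forall x x', R x x' -> R (neg x) (neg x');
  cong_box : forall x x', R x x' -> R (box x) (box x') }.

Definition generated_congruence (A : algebra) (S : set (A * A)) :
    A -> A -> Prop :=
  fun x y => forall R, congruence R ->
    (forall p, S p -> R p.1 p.2) -> R x y.

Section Quotient.
Variables (A : algebra) (R : A -> A -> Prop).

Definition quotient_carrier : Type :=
  {K : A -> Prop | exists x, K = R x}.

Definition quotient_class (x : A) : quotient_carrier :=
  exist (fun K : A -> Prop => exists x, K = R x) (R x) (ex_intro _ x erefl).

Definition quotient_repr (K : quotient_carrier) : A :=
  projT1 (cid (proj2_sig K)).

(* Operations act on chosen representatives; when [R] is a congruence the
   result does not depend on the choice. *)
Definition quotient : algebra :=
  @Algebra quotient_carrier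
    (fun K L => quotient_class (meet (quotient_repr K) (quotient_repr L)))
    (fun K L => quotient_class (join (quotient_repr K) (quotient_repr L)))
    (fun K => quotient_class (neg (quotient_repr K)))
    (quotient_class bot)
    (quotient_class top)
    (fun K => quotient_class (box (quotient_repr K))).

End Quotient.

Definition free_algebra (V : algebra -> Prop) (X : Type) (F : algebra)
    (iota : X -> F) : Prop :=
  V F /\
  forall B : algebra, V B -> forall g : X -> B,
    exists! h : F -> B, homomorphism h /\ forall x, h (iota x) = g x.

Definition finitely_presented (V : algebra -> Prop) (A : algebra) : Prop :=
  exists (n : nat) (F : algebra) (iota : 'I_n -> F) (S : set (F * F)),
    [/\ free_algebra V iota, finite_set S &
        isomorphic A (quotient (generated_congruence S))].

Definition coherent (V : algebra -> Prop) : Prop :=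
  forall A : algebra, V A -> finitely_presented V A ->
  forall G : set A, finite_set G ->
    finitely_presented V (generated_subalgebra G).

Definition right_uniform_deductive_interpolation (V : algebra -> Prop) : Prop :=
  forall (x y : set nat) (S : set equation),
    finite_set x -> finite_set y -> x `&` y = set0 ->
    finite_set S -> (forall e, S e -> eq_vars e `<=` x `|` y) ->
    exists P : set equation,
      [/\ finite_set P, forall e, P e -> eq_vars e `<=` y &
          forall (z : set nat) (e : equation),
            z `&` (x `|` y) = set0 -> eq_vars e `<=` y `|` z ->
            (consequence V S e <-> consequence V P e)].

(* First-order formulas over the signature expanded by constants from [C]; in an
   atom, [inl c] is the constant [c] and [inr n] the [n]-th variable. *)
Inductive formula (C : Type) : Type :=
| FEq of term (C + nat) & term (C + nat)
| FNot of formula C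
| FAnd of formula C & formula C
| FOr of formula C & formula C
| FImp of formula C & formula C
| FAll of nat & formula C
| FEx of nat & formula C.

Definition upd (A : Type) (v : nat -> A) (n : nat) (a : A) : nat -> A :=
  fun m => if m == n then a else v m.

Fixpoint holds (A : algebra) (C : Type) (c : C -> A) (v : nat -> A)
    (f : formula C) : Prop :=
  match f with
  | FEq t s =>
      let w x := match x with inl k => c k | inr n => v n end in
      eval w t = eval w s
  | FNot g => ~ holds c v g
  | FAnd g h => holds c v g /\ holds c v h
  | FOr g h => holds c v g \/ holds c v h
  | FImp g h => holds c v g -> holds c v h
  | FAll n g => forall a : A, holds c (upd v n a) g
  | FEx n g => exists a : A, holds c (upd v n a) g
  end.

Fixpoint free_vars (C : Type) (f : formula C) : set nat :=
  match f with
  | FEq t s => [set n | (tvars t `|` tvars s) (inr n)]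
  | FNot g => free_vars g
  | FAnd g h | FOr g h | FImp g h => free_vars g `|` free_vars h
  | FAll n g | FEx n g => free_vars g `\ n
  end.

Fixpoint quantifier_free (C : Type) (f : formula C) : Prop :=
  match f with
  | FEq _ _ => True
  | FNot g => quantifier_free g
  | FAnd g h | FOr g h | FImp g h => quantifier_free g /\ quantifier_free h
  | FAll _ _ | FEx _ _ => False
  end.

Definition sentence (C : Type) (f : formula C) : Prop := free_vars f = set0.

(* For a sentence [f], the choice of valuation is irrelevant. *)
Definition satisfies (A : algebra) (C : Type) (c : C -> A) (f : formula C) :
    Prop :=
  forall v : nat -> A, holds c v f.

Definition model (A : algebra) (C : Type) (c : C -> A) (T : set (formula C)) :
    Prop :=
  forall f, T f -> satisfies c f.

Definition entails (C : Type) (T : set (formula C)) (f : formula C) : Prop :=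
  forall (A : algebra) (c : C -> A), model c T -> satisfies c f.

Definition complete_theory (C : Type) (T : set (formula C)) : Prop :=
  forall f, sentence f -> entails T f \/ entails T (FNot f).

(* The language of modal algebras itself is the case [C = void]. *)

Fixpoint lift_term (C : Type) (t : term (void + nat)) : term (C + nat) :=
  match t with
  | Var (inl k) => Var (inl (of_void C k))
  | Var (inr n) => Var (inr n)
  | TMeet s u => TMeet (lift_term C s) (lift_term C u)
  | TJoin s u => TJoin (lift_term C s) (lift_term C u)
  | TNeg s => TNeg (lift_term C s)
  | TBot => TBot
  | TTop => TTop
  | TBox s => TBox (lift_term C s)
  end.

Fixpoint lift_formula (C : Type) (f : formula void) : formula C :=
  match f with
  | FEq t s => FEq (lift_term C t) (lift_term C s)
  | FNot g => FNot (lift_formula C g)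
  | FAnd g h => FAnd (lift_formula C g) (lift_formula C h)
  | FOr g h => FOr (lift_formula C g) (lift_formula C h)
  | FImp g h => FImp (lift_formula C g) (lift_formula C h)
  | FAll n g => FAll n (lift_formula C g)
  | FEx n g => FEx n (lift_formula C g)
  end.

Definition first_order_theory (V : algebra -> Prop) : set (formula void) :=
  [set f | sentence f /\ forall A : algebra, V A -> satisfies (of_void A) f].

Definition qf_diagram (M : algebra) : set (formula M) :=
  [set f | [/\ sentence f, quantifier_free f & satisfies (@id M) f]].

Definition model_completion (T U : set (formula void)) : Prop :=
  [/\ U `<=` @sentence void,
      T `<=` U,
      forall M : algebra, model (of_void M) T ->
        exists N : algebra, model (of_void N) U /\ embeds M N &
      forall M : algebra, model (of_void M) T ->
        complete_theory (lift_formula M @` U `|` @qf_diagram M)].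

Definition has_model_completion (T : set (formula void)) : Prop :=
  exists U : set (formula void), model_completion T U.

(* Main.v *)
(* The equations z <= y <= x, boxdot y = y have as consequences in x, z exactly
   those of the infinite set z <= boxdot^k x (k in N): an algebra of V satisfying
   the latter embeds into its canonical extension, where y = /\_k boxdot^k x is
   fixed by boxdot, because box preserves meets of chains from the algebra.
   If finitely many equations in x, z axiomatized these consequences, then by
   compactness z <= boxdot^n x would imply z <= boxdot^{n+1} x for some n, and
   z := boxdot^n x would give weak transitivity.  A uniform interpolant is such an
   axiomatization, and so is a finite presentation of the subalgebra generated by
   x, z in the algebra presented by the above equations.  For model completions,
   an ultraproduct M of models N_n of T* containing z <= boxdot^n x with
   z </= boxdot^{n+1} x is a model of T* without the required y, but some model of
   T* extending M contains one, so T* with the diagram of M is not complete. *)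
From mathcomp Require Import all_boot.
From mathcomp Require Import boolp classical_sets cardinality.
Require Import Defs.

Set Implicit Arguments.
Unset Strict Implicit.
Unset Printing Implicit Defensive.

Local Open Scope classical_set_scope.

(** By induction on the size of [S]: stages merge pairwise, so finitely many requirements are met at
    one stage. Below, [D] is an ultrafilter or its complement when stages are elements of an
    algebra, and trivial when they are numbers. *)
Lemma finite_directed (T I : Type) (D : I -> Prop) (Q : I -> T -> Prop)
    (S : set T) :
  finite_set S -> (exists i, D i) ->
  (forall i j, D i -> D j ->
     exists k, D k /\ forall x, Q i x \/ Q j x -> Q k x) ->
  (forall x, S x -> exists i, D i /\ Q i x) ->
  exists i, D i /\ forall x, S x -> Q i x.
Proof.
move=> /finite_setP[n]; elim: n S => [|n IHn] S.
  by rewrite II0 card_eq0 => /eqP-> [i Di] _ _; exists i.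
move=> /eq_cardSP[x Sx Sn] D0 Ddir SQ.
have [i [Di Qi]] : exists i, D i /\ forall y, (S `\ x) y -> Q i y.
  by apply: IHn => // y [Sy _]; exact: SQ.
have [j [Dj Qj]] := SQ x Sx.
have [k [Dk Qk]] := Ddir i j Di Dj.
exists k; split=> // y Sy; apply: Qk.
by have [->|yx] := pselect (y = x); [right|left; apply: Qi].
Qed.

(** * Order in Boolean algebras *)

Section BooleanTheory.
Variable A : algebra.
Hypothesis bA : boolean_algebra A.
Implicit Types x y z : A.

Lemma ale_joinE x y : ale x y <-> join x y = y.
Proof.
rewrite /ale; split=> xy; last by rewrite -xy meet_absorb.
by rewrite -{1}xy join_comm // meet_comm // join_absorb.
Qed.

Lemma meet_idem x : meet x x = x.
Proof. by rewrite -{2}[x](join_bot bA) meet_absorb. Qed.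

Lemma ale_refl x : ale x x.
Proof. exact: meet_idem. Qed.

Lemma ale_anti x y : ale x y -> ale y x -> x = y.
Proof. by move=> xy yx; rewrite -xy meet_comm. Qed.

Lemma ale_trans x y z : ale x y -> ale y z -> ale x z.
Proof. by rewrite /ale => xy yz; rewrite -{1}xy -meet_assoc // yz. Qed.

Lemma ale_meetl x y : ale (meet x y) x.
Proof. by rewrite /ale meet_comm // meet_assoc // meet_idem. Qed.

Lemma ale_meetr x y : ale (meet x y) y.
Proof. by rewrite meet_comm //; exact: ale_meetl. Qed.

Lemma ale_meet x y z : ale z x -> ale z y -> ale z (meet x y).
Proof. by rewrite /ale => zx zy; rewrite meet_assoc // zx. Qed.

Lemma ale_joinl x y : ale x (join x y).
Proof. exact: meet_absorb. Qed.

Lemma ale_joinr x y : ale y (join x y).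
Proof. by rewrite join_comm //; exact: ale_joinl. Qed.

Lemma ale_top x : ale x top.
Proof. exact: meet_top. Qed.

Lemma ale_bot x : ale bot x.
Proof. by apply/ale_joinE; rewrite join_comm // join_bot. Qed.

Lemma meet_neg_split x y : x = join (meet x y) (meet x (neg y)).
Proof.
rewrite -[LHS](meet_top bA) -(join_neg bA y) meet_comm // meet_distr //.
by congr join; exact: meet_comm.
Qed.

Lemma ale_meet_neg_bot x y : meet x (neg y) = bot -> ale x y.
Proof. by move=> xy; rewrite /ale [RHS](meet_neg_split x y) xy join_bot. Qed.

Lemma meet_bot_ale_neg x y : meet x y = bot -> ale x (neg y).
Proof.
move=> xy; rewrite /ale [RHS](meet_neg_split x y) xy.
by rewrite join_comm // join_bot.
Qed.

End BooleanTheory.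

(** * Filters and ultrafilters *)

Record proper_filter (A : algebra) (U : A -> Prop) : Prop := ProperFilter {
  filter_top : U top;
  filter_meet : forall x y, U x -> U y -> U (meet x y);
  filter_up : forall x y, ale x y -> U x -> U y;
  filter_bot : ~ U bot }.

Record ultrafilter (A : algebra) (U : A -> Prop) : Prop := Ultrafilter {
  ultra_filter : proper_filter U;
  ultra_neg : forall x, U x \/ U (neg x) }.

Lemma ultrafilter_extension (A : algebra) (F : A -> Prop) :
  boolean_algebra A -> proper_filter F ->
  exists U : A -> Prop, ultrafilter U /\ forall x, F x -> U x.
Proof.
move=> bA pF.
(* [Zorn_bigcup] also covers the empty chain, whose union is empty; the guard admits the empty set
   into [P]. *)
pose P : set (set A) := fun X => X !=set0 -> F `<=` X /\ proper_filter X.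
have [|U [PU maxU]] := @Zorn_bigcup A P.
  move=> C CP Ctot [x [X CX Xx]].
  have sup Y a : C Y -> Y a -> F `<=` Y /\ proper_filter Y.
    by move=> CY Ya; apply: CP => //; exists a.
  have [FX fX] := sup X x CX Xx.
  split; first by move=> a Fa; exists X => //; exact: FX.
  split.
  - by exists X => //; exact: filter_top fX.
  - move=> a b [Y CY Ya] [Z CZ Zb].
    have [YZ|ZY] := Ctot _ _ CY CZ.
      by exists Z => //; apply: (filter_meet (sup Z b CZ Zb).2) => //; exact: YZ.
    by exists Y => //; apply: (filter_meet (sup Y a CY Ya).2) => //; exact: ZY.
  - move=> a b ab [Y CY Ya]; exists Y => //.
    exact: (filter_up (sup Y a CY Ya).2 ab).
  - by move=> [Y CY Yb]; exact: (filter_bot (sup Y _ CY Yb).2).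
(* The empty set is not maximal in [P], as it lies strictly below [F]. *)
have U0 : U !=set0.
  apply: contrapT => U0; apply: (maxU F); last by move=> _; split.
  split=> [x Ux|FU]; first by case: U0; exists x.
  by apply: U0; exists top; apply: FU; exact: filter_top pF.
have [FU fU] := PU U0.
exists U; split=> //; split=> // x.
apply: contrapT => /not_orP[Ux Unx].
(* The filter generated by [U] and [x]. It is proper because [meet a x = bot] with [U a] would put
   [neg x] into [U]. *)
pose W : set A := fun b => exists2 a, U a & ale (meet a x) b.
have UW a : U a -> W a by exists a => //; exact: ale_meetl.
have Wx : W x by exists top; [exact: filter_top fU|exact: ale_meetr].
apply: (maxU W); first by split=> // WU; apply: Ux; exact: WU.
move=> _; split; first by move=> a /FU; exact: UW.
split.
- exact/UW/(filter_top fU).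
- move=> a b [a' Ua' aa'] [b' Ub' bb']; exists (meet a' b').
    exact: filter_meet fU _ _ Ua' Ub'.
  have le1 := ale_meetl bA (meet a' b') x.
  have le2 := ale_meetr bA (meet a' b') x.
  apply: ale_meet => //.
    apply: ale_trans aa' => //; apply: ale_meet => //.
    by apply: ale_trans le1 _ => //; exact: ale_meetl.
  apply: ale_trans bb' => //; apply: ale_meet => //.
  by apply: ale_trans le1 _ => //; exact: ale_meetr.
- by move=> a b ab [c Uc ca]; exists c => //; exact: ale_trans ca ab.
- move=> [a Ua ax]; apply: Unx; apply: filter_up Ua => //.
  apply: meet_bot_ale_neg => //; apply: ale_anti => //; last exact: ale_bot.
Qed.

(** The principal filter of [meet a (neg b)] is proper, since this meet is [bot] only if [a] is
    below [b]. An ultrafilter extending it contains [a] and [neg b]. *)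
Lemma ultrafilter_separation (A : algebra) (a b : A) : boolean_algebra A ->
  ~ ale a b -> exists U : A -> Prop, [/\ ultrafilter U, U a & ~ U b].
Proof.
move=> bA ab.
have [|U [uU UF]] := @ultrafilter_extension A (ale (meet a (neg b))) bA.
  split; [exact: ale_top|by move=> *; exact: ale_meet| |].
    by move=> x y xy ax; exact: ale_trans xy.
  move=> h; apply: ab; apply: ale_meet_neg_bot => //.
  by apply: ale_anti => //; exact: ale_bot.
have fU := ultra_filter uU.
exists U; split=> //; first by apply: UF; exact: ale_meetl.
move=> Ub; apply: (filter_bot fU); rewrite -(meet_neg bA b).
by apply: (filter_meet fU) => //; apply: UF; exact: ale_meetr.
Qed.

Section UltrafilterTheory.
Variables (A : algebra) (U : A -> Prop).
Hypotheses (bA : boolean_algebra A) (uU : ultrafilter U).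
Let fU := ultra_filter uU.

Lemma ultra_meetE x y : U (meet x y) <-> U x /\ U y.
Proof.
split=> [Uxy|[Ux Uy]]; last exact: filter_meet fU _ _ Ux Uy.
by split; apply: filter_up Uxy => //; [exact: ale_meetl|exact: ale_meetr].
Qed.

Lemma ultra_negE x : U (neg x) <-> ~ U x.
Proof.
split=> [Unx Ux|]; last by have [] := ultra_neg uU x.
by apply: (filter_bot fU); rewrite -(meet_neg bA x); exact/ultra_meetE.
Qed.

Lemma ultra_joinE x y : U (join x y) <-> U x \/ U y.
Proof.
split=> [Uxy|[Ux|Uy]]; last 2 first.
- by apply: filter_up Ux => //; exact: ale_joinl.
- by apply: filter_up Uy => //; exact: ale_joinr.
apply: contrapT => /not_orP[/ultra_negE Unx /ultra_negE Uny].
apply: (filter_bot fU); rewrite -(meet_neg bA (join x y)).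
apply/ultra_meetE; split=> //.
apply: (filter_up fU) (filter_meet fU Unx Uny).
(* De Morgan: [meet (neg x) (neg y)] is disjoint from [join x y]. *)
apply: meet_bot_ale_neg => //; rewrite meet_comm // meet_distr //.
rewrite meet_assoc // meet_neg // [meet (neg x) _]meet_comm // meet_assoc //.
rewrite meet_neg // [meet bot _]ale_bot // [meet bot _]ale_bot //.
exact: join_bot.
Qed.

End UltrafilterTheory.
(** * The Stone representation as canonical extension *)

(** The box is a parameter so that the same facts serve sets of ultrafilters, with [pi_box], and
    subsets of [nat], with [id], whose ultrafilters give the ultraproducts. *)
Definition powerset_algebra (X : Type) (b : (X -> Prop) -> X -> Prop) : algebra :=
  @Algebra (X -> Prop) (fun P Q x => P x /\ Q x) (fun P Q x => P x \/ Q x)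
    (fun P x => ~ P x) (fun _ => False) (fun _ => True) b.

Lemma powerset_boolean (X : Type) (b : (X -> Prop) -> X -> Prop) :
  boolean_algebra (powerset_algebra b).
Proof.
by split=> /=; repeat intro; apply/funext => u /=; apply/propext;
  have [] := EM (x u); tauto.
Qed.

Lemma powerset_aleE (X : Type) (b : (X -> Prop) -> X -> Prop)
    (P Q : powerset_algebra b) :
  ale P Q <-> forall x, P x -> Q x.
Proof.
split=> [<- x []//|PQ]; apply/funext => x; apply/propext => /=.
by split=> [[]//|Px]; split=> //; exact: PQ.
Qed.

Lemma powerset_lub (X : Type) (b : (X -> Prop) -> X -> Prop)
    (S : set (powerset_algebra b)) (P : powerset_algebra b) :
  is_lub (@ale _) S P <-> forall x, P x <-> exists Q, S Q /\ Q x.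
Proof.
split=> [[ub least] x|PS].
  split=> [Px|[Q [SQ Qx]]]; last by move/powerset_aleE: (ub Q SQ); apply.
  have /powerset_aleE : ale P ((fun x => exists Q, S Q /\ Q x) : powerset_algebra b).
    by apply: least => Q SQ; apply/powerset_aleE => y Qy; exists Q.
  exact.
split=> [Q SQ|R RS]; apply/powerset_aleE => x; first by move=> ?; apply/PS; exists Q.
by move=> /PS[Q [SQ Qx]]; move/powerset_aleE: (RS Q SQ); apply.
Qed.

Lemma powerset_glb (X : Type) (b : (X -> Prop) -> X -> Prop)
    (S : set (powerset_algebra b)) (P : powerset_algebra b) :
  is_glb (@ale _) S P <-> forall x, P x <-> forall Q, S Q -> Q x.
Proof.
split=> [[lb great] x|PS].
  split=> [Px Q SQ|Sx]; first by move/powerset_aleE: (lb Q SQ); apply.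
  have /powerset_aleE : ale ((fun x => forall Q, S Q -> Q x) : powerset_algebra b) P.
    by apply: great => Q SQ; apply/powerset_aleE => y Qy; exact: Qy.
  exact.
split=> [Q SQ|R RS]; apply/powerset_aleE => x; first by move=> /PS; apply.
by move=> Rx; apply/PS => Q SQ; move/powerset_aleE: (RS Q SQ); apply.
Qed.

Section CanonicalExtension.
Variable A : algebra.
Hypothesis bA : boolean_algebra A.

Definition ultra := {U : A -> Prop | ultrafilter U}.

(** Ultrafilters are maximal: an element of [W] outside [U] would have its negation in [U], hence in
    [W]. *)
Lemma ultra_sub_eq (U W : ultra) :
  (forall a, sval U a -> sval W a) -> U = W.
Proof.
case: U W => [U uU] [W uW] /= UW.
suff E : U = W by case: _ / E in uW *; congr exist; exact: Prop_irrelevance.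
apply/funext => a; apply/propext; split=> [|Wa]; first exact: UW.
apply: contrapT => /(ultra_negE bA uU)/UW.
by move=> /(ultra_negE bA uW).
Qed.

Definition stone (a : A) : ultra -> Prop := fun U => sval U a.

(* [closed_part], [open_part] and [pi_box] spell out [closed_elt], [open_elt] and
   [box_pi] pointwise on sets of ultrafilters; the definition of [stone_algebra]
   needs the box before there is an algebra to state them in. *)
Definition closed_part (P : ultra -> Prop) : Prop :=
  exists2 S : set A, S !=set0 & forall U, P U <-> forall a, S a -> stone a U.

Definition open_part (P : ultra -> Prop) : Prop :=
  exists2 S : set A, S !=set0 & forall U, P U <-> exists2 a, S a & stone a U.

Definition pi_box (P : ultra -> Prop) : ultra -> Prop := fun U =>
  forall p q : ultra -> Prop, closed_part p -> open_part q ->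
    (forall W, p W -> P W) -> (forall W, P W -> q W) ->
    exists a, [/\ forall W, p W -> stone a W, forall W, stone a W -> q W &
                  stone (box a) U].

Definition stone_algebra : algebra := powerset_algebra pi_box.
Local Notation C := stone_algebra.
Local Notation i := (stone : A -> C).

Lemma stone_closedE (P : C) : closed_elt (@ale C) i P <-> closed_part P.
Proof.
split=> [[S [S0 /powerset_glb PS]]|[S S0 PS]]; exists S => //.
  move=> U; apply: (iff_trans (PS U)); split=> [h a Sa|h _ [a Sa <-]].
    by apply: h; exists a.
  exact: h.
split=> //; apply/powerset_glb => U; apply: (iff_trans (PS U)).
by split=> [h _ [a Sa <-]|h a Sa]; [exact: h|apply: h; exists a].
Qed.

Lemma stone_openE (P : C) : open_elt (@ale C) i P <-> open_part P.
Proof.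
split=> [[S [S0 /powerset_lub PS]]|[S S0 PS]]; exists S => //.
  move=> U; apply: (iff_trans (PS U)); split=> [[_ [[a Sa <-] ?]]|[a Sa aU]].
    by exists a.
  by exists (stone a); split=> //; exists a.
split=> //; apply/powerset_lub => U; apply: (iff_trans (PS U)).
split=> [[a Sa aU]|[_ [[a Sa <-] aU]]]; last by exists a.
by exists (stone a); split=> //; exists a.
Qed.

Lemma stone_closed (a : A) : closed_part (stone a).
Proof. by exists [set a] => [|U]; [exists a|split=> [? _ ->|]//; exact]. Qed.

Lemma stone_open (a : A) : open_part (stone a).
Proof. by exists [set a] => [|U]; [exists a|split=> [|[_ ->]]//; exists a]. Qed.

Lemma stone_ale (a b : A) : ale a b <-> ale (i a) (i b).
Proof.
split=> [ab|/powerset_aleE ab].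
  by apply/powerset_aleE => -[U uU]; exact: filter_up (ultra_filter uU) _ _ ab.
apply: contrapT => /(ultrafilter_separation bA)[U [uU Ua Ub]].
exact/Ub/(ab (exist _ U uU)).
Qed.

Lemma stone_inj : injective i.
Proof.
by move=> a b ab; apply: ale_anti => //; apply/stone_ale; rewrite ab;
  apply: ale_refl; exact: powerset_boolean.
Qed.

Lemma stone_hom : homomorphism i.
Proof.
split.
- by move=> a b; apply/funext => -[U uU]; apply/propext; exact: ultra_meetE.
- by move=> a b; apply/funext => -[U uU]; apply/propext; exact: ultra_joinE.
- by move=> a; apply/funext => -[U uU]; apply/propext; exact: ultra_negE.
- apply/funext => -[U uU]; apply/propext; split=> //.
  exact: filter_bot (ultra_filter uU).
- apply/funext => -[U uU]; apply/propext; split=> // _.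
  exact: filter_top (ultra_filter uU).
- move=> a; apply/funext => U; apply/propext; split=> [Ua|].
    by move=> p q _ _ pa aq; exists a.
  (* With [stone a] as both the closed and the open bound, only [a] itself lies in between. *)
  move=> /(_ (stone a) (stone a) (stone_closed a) (stone_open a)).
  case=> // b [ab ba]; rewrite (_ : b = a) //.
  by apply: ale_anti => //; apply/stone_ale/powerset_aleE.
Qed.

Lemma stone_completion : completion (@ale A) (@ale C) i.
Proof.
have bC : boolean_algebra C by exact: powerset_boolean.
split.
- split; [exact: ale_refl|exact: ale_anti|exact: ale_trans|move=> S; split].
    by exists (fun U => exists P, S P /\ P U); exact/powerset_lub.
  by exists (fun U => forall P, S P -> P U); exact/powerset_glb.
- exact: stone_ale.
- move=> S p fS [lb great]; apply/powerset_glb => -[U uU] /=.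
  have fU := ultra_filter uU.
  split=> [Up _ [s Ss <-]|US].
    exact: filter_up fU _ _ (lb s Ss) Up.
  (* An ultrafilter containing the finite set [S] contains a lower bound of it. *)
  have [|a b Ua Ub|s Ss|a [Ua aS]] := finite_directed (D := U) (Q := @ale A) fS.
  + by exists top; exact: filter_top fU.
  + exists (meet a b); split; first exact: filter_meet fU _ _ Ua Ub.
    move=> x [ax|bx]; first exact: ale_trans (ale_meetl bA a b) ax.
    exact: ale_trans (ale_meetr bA a b) bx.
  + exists s; split; last exact: ale_refl.
    by apply: (US (i s)); exists s.
  + exact: filter_up fU _ _ (great a aS) Ua.
- move=> S p fS [ub least]; apply/powerset_lub => -[U uU] /=.
  have fU := ultra_filter uU.
  split=> [Up|[_ [[s Ss <-] Us]]]; last exact: filter_up fU _ _ (ub s Ss) Us.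
  apply: contrapT => nUS.
  (* Dually, the complement of an ultrafilter is closed under joins, so it contains an upper bound
     of [S]. *)
  have [|a b Ua Ub|s Ss|a [Ua aS]] :=
    finite_directed (D := fun a => ~ U a) (Q := fun a s => ale s a) fS.
  + by exists bot; exact: filter_bot fU.
  + exists (join a b); split.
      by move=> /(ultra_joinE bA uU)[].
    move=> x [xa|xb]; first exact: ale_trans xa (ale_joinl bA a b).
    exact: ale_trans xb (ale_joinr bA a b).
  + exists s; split; last exact: ale_refl.
    by move=> Us; apply: nUS; exists (i s); split=> //; exists s.
  + by apply: Ua; exact: filter_up fU _ _ (least a aS) Up.
Qed.

(** The singleton of [U] is closed, being the meet of the elements of [U], and its complement is
    open, being the join of the elements outside [U]. Every set is a union of singletons and an
    intersection of complements of singletons. *)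
Lemma stone_dense : dense_completion (@ale C) i.
Proof.
move=> P; split.
- exists [set Q : C | exists2 U, P U & Q = fun W => W = U]; split.
    move=> _ [U PU ->]; apply/stone_closedE; exists (sval U).
      by exists top; exact: filter_top (ultra_filter (svalP U)).
    by move=> W; split=> [->//|UW]; apply/esym/ultra_sub_eq.
  apply/powerset_lub => U; split=> [PU|[_ [[W PW ->] ->//]]].
  by exists (fun W => W = U); split=> //; exists U.
- exists [set Q : C | exists2 U, ~ P U & Q = fun W => W <> U]; split.
    move=> _ [U PU ->]; apply/stone_openE; exists (fun a => ~ sval U a).
      by exists bot; exact: filter_bot (ultra_filter (svalP U)).
    move=> W; split=> [WU|[a Ua Wa] WU]; last by apply: Ua; rewrite -WU.
    apply: contrapT => nUW; apply: WU; apply: ultra_sub_eq => a Wa.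
    by apply: contrapT => Ua; apply: nUW; exists a.
  apply/powerset_glb => U; split=> [PU _ [W PW ->] UW|h].
    by apply: PW; rewrite -UW.
  apply: contrapT => PU.
  by apply: (h (fun W => W <> U) _ erefl); exists U.
Qed.

(** If no finite parts suffice, the elements of [A] containing some finite meet from [K] minus a
    finite join from [O] form a proper filter. An ultrafilter extending it is a point of [a] outside
    [b]. *)
Lemma stone_compact : compact_completion (@ale C) i.
Proof.
have bC : boolean_algebra C by exact: powerset_boolean.
move=> K O a b [k0 Kk0] [o0 Oo0] cK oO /[dup] aK [lbK _] /[dup] bO [ubO _].
split=> [/powerset_aleE ab|]; last first.
  move=> [K0 [O0 [a0 [b0 [_ _ [K0K O0O] [[_ glbK0] [_ lubO0]] ab0]]]]].
  have le_a : ale a a0 by apply: glbK0 => y /K0K; exact: lbK.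
  have le_b : ale b0 b by apply: lubO0 => y /O0O; exact: ubO.
  by apply: (ale_trans bC le_a); exact: (ale_trans bC ab0 le_b).
pose good (K0 O0 : set C) (c : A) := [/\ finite_set K0 /\ finite_set O0,
  K0 !=set0 /\ O0 !=set0, K0 `<=` K /\ O0 `<=` O &
  forall U, (forall k, K0 k -> k U) -> (forall o, O0 o -> ~ o U) -> stone c U].
pose F (c : A) := exists K0 O0, good K0 O0 c.
have F1 k o c : K k -> O o -> (forall U, k U -> ~ o U -> stone c U) -> F c.
  move=> Kk Oo koc; exists [set k], [set o]; split.
  - by split; exact: finite_set1.
  - by split; [exists k|exists o].
  - by split=> _ ->.
  - by move=> U Uk Uo; apply: koc; [exact: Uk|exact: Uo].
(* [F bot] says that some finite meet from [K] is covered by a finite join from [O]. *)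
have [[K0 [O0 [fin ne sub h]]]|nbot] := pselect (F bot).
  exists K0, O0, (fun U => forall k, K0 k -> k U),
    (fun U => exists o, O0 o /\ o U).
  split=> //; first by split; [exact/powerset_glb|exact/powerset_lub].
  apply/powerset_aleE => U UK; apply: contrapT => UO.
  apply: (filter_bot (ultra_filter (svalP U))); apply: h => // o Oo Uo.
  by apply: UO; exists o.
have [|U [uU FU]] := @ultrafilter_extension A F bA.
  split=> //.
  - apply: (F1 k0 o0) => // U _ _; exact: filter_top (ultra_filter (svalP U)).
  - move=> c d [K1 [O1 [[fK1 fO1] [[k1 Kk1] [o1 Oo1]] [K1K O1O] h1]]].
    move=> [K2 [O2 [[fK2 fO2] _ [K2K O2O] h2]]].
    exists (K1 `|` K2), (O1 `|` O2); split.
    + by split; rewrite finite_setU.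
    + by split; [exists k1; left|exists o1; left].
    + by split=> x [|]; auto.
    + move=> U UK UO; apply/(ultra_meetE bA (svalP U)); split.
        by apply: h1 => x ?; [apply: UK|apply: UO]; left.
      by apply: h2 => x ?; [apply: UK|apply: UO]; right.
  - move=> c d cd [K0 [O0 [fin ne sub h]]]; exists K0, O0; split=> // U UK UO.
    exact: filter_up (ultra_filter (svalP U)) _ _ cd (h U UK UO).
pose u : ultra := exist _ U uU.
have : a u.
  (* A closed [k] is a meet of elements of [A], each of which is in [F]. *)
  move/powerset_glb: aK => ->; move=> k Kk.
  have /stone_closedE[S S0 kS] := cK k Kk.
  apply/kS => s Ss; apply: FU; apply: (F1 k o0) => // W /kS kW _; exact: kW.
move/ab; move/powerset_lub: bO => -> [o [Oo ou]].
have /stone_openE[T T0 oT] := oO o Oo.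
have [t Tt ut] := (oT u).1 ou.
suff : U (neg t) by move/(ultra_negE bA uU); exact.
(* Since [t] is below [o], a point outside [o] lies in [neg t]. *)
apply: FU; apply: (F1 k0 o) => // W _ Wo; apply/(ultra_negE bA (svalP W)) => Wt.
by apply: Wo; apply/oT; exists t.
Qed.

Lemma stone_canonical : canonical_extension i.
Proof.
split; first exact: powerset_boolean.
  by split; [exact: stone_completion|exact: stone_dense|exact: stone_compact].
move=> P; apply/powerset_glb => U; split=> [PU Z [p [q [pK qO [pP Pq]]]]|h].
  move/powerset_lub => ->; move/stone_closedE: pK => pK; move/stone_openE: qO => qO.
  move/powerset_aleE: pP => pP; move/powerset_aleE: Pq => Pq.
  have [a [pa aq Ua]] := PU p q pK qO pP Pq.
  by exists (stone (box a)); split=> //; exists a; split=> //; exact/powerset_aleE.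
move=> p q pK qO pP Pq.
(* The join of the [box a] with [a] between [p] and [q], as a set of ultrafilters. *)
pose z : C := fun W => exists a, [/\ forall W, p W -> stone a W,
  forall W, stone a W -> q W & stone (box a) W].
apply: (h z); exists p, q; split; [exact/stone_closedE|exact/stone_openE| |].
  by split; exact/powerset_aleE.
apply/powerset_lub => W; split=> [[a [pa aq aW]]|[_ [[a [pa aq ->]] aW]]].
  by exists (stone (box a)); split=> //; exists a; split=> //; exact/powerset_aleE.
move/powerset_aleE: pa => pa; move/powerset_aleE: aq => aq.
by exists a; split.
Qed.

End CanonicalExtension.

(** * Fixpoints of boxdot in canonical extensions *)

Definition boxdot (A : algebra) (x : A) : A := meet (box x) x.

Section FixpointExtension.
Variable V : algebra -> Prop.
Hypothesis V_modal : forall A : algebra, V A -> modal_algebra A.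

Lemma boxdot_ale (A : algebra) (x : A) : V A -> ale (boxdot x) x.
Proof. by move=> /V_modal/modal_boolean bA; exact: ale_meetr. Qed.

Lemma boxdot_mono (A : algebra) (x y : A) :
  V A -> ale x y -> ale (boxdot x) (boxdot y).
Proof.
move=> /V_modal[bA _ boxM] xy; apply: ale_meet => //.
  apply: (ale_trans bA (ale_meetl bA _ _)).
  by rewrite /ale -boxM xy.
exact: (ale_trans bA (ale_meetr bA _ _)).
Qed.

Lemma iter_boxdot_mono n (A : algebra) (x y : A) :
  V A -> ale x y -> ale (iter n (@boxdot A) x) (iter n (@boxdot A) y).
Proof. by move=> VA xy; elim: n => //= n; exact: boxdot_mono. Qed.

Lemma iter_boxdot_anti m n (A : algebra) (x : A) :
  V A -> (m <= n)%N -> ale (iter n (@boxdot A) x) (iter m (@boxdot A) x).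
Proof.
move=> VA; have bA := modal_boolean (V_modal VA).
elim: n => [|n IHn]; first by rewrite leqn0 => /eqP->; exact: ale_refl.
rewrite leq_eqVlt => /orP[/eqP->|/IHn]; first exact: ale_refl.
by apply: ale_trans => //; exact: boxdot_ale.
Qed.

Lemma iter_boxdot_fix n (A : algebra) (x : A) :
  boxdot x = x -> iter n (@boxdot A) x = x.
Proof. by move=> xx; elim: n => //= n ->. Qed.

Lemma hom_iter_boxdot (A B : algebra) (f : A -> B) n (x : A) :
  homomorphism f -> f (iter n (@boxdot A) x) = iter n (@boxdot B) (f x).
Proof.
by move=> hf; elim: n => //= n IHn; rewrite /boxdot hom_meet // hom_box // IHn.
Qed.

Lemma hom_ale (A B : algebra) (f : A -> B) (x y : A) :
  homomorphism f -> ale x y -> ale (f x) (f y).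
Proof. by move=> hf xy; rewrite /ale -hom_meet // xy. Qed.

Lemma inj_hom_ale (A B : algebra) (f : A -> B) (x y : A) :
  homomorphism f -> injective f -> ale (f x) (f y) -> ale x y.
Proof. by move=> hf fI; rewrite /ale -hom_meet // => /fI. Qed.

(* By compactness, an open [q] above the meet [y] of the decreasing chain
   [boxdot^k x] is above some [boxdot^k x]; this gives [y <= box y]. *)
Lemma fixpoint_extension (A : algebra) (x : A) :
  closed_under_canonical_extensions V -> V A ->
  exists (C : algebra) (j : A -> C) (y : C),
    [/\ V C, homomorphism j, injective j &
        [/\ boxdot y = y, ale y (j x) &
            forall z, (forall k, ale z (iter k (@boxdot A) x)) -> ale (j z) y]].
Proof.
move=> V_can VA; have [bA _ _] := V_modal VA.
pose C := stone_algebra A; pose j : A -> C := @stone A.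
have jcan : canonical_extension j := stone_canonical bA.
have VC : V C := V_can _ _ _ VA jcan.
have bC := modal_boolean (V_modal VC).
have hj : homomorphism j := stone_hom bA.
pose a k := iter k (@boxdot A) x.
pose y : C := fun U => forall k, j (a k) U.
have y_le k : ale y (j (a k)) by apply/powerset_aleE => U; exact.
exists C, j, y; split=> //; [exact: stone_inj|split].
- rewrite /boxdot meet_comm //; apply/powerset_aleE => U yU.
  move=> p q pK qO py yq.
  have [k ak_q] : exists k, ale (j (a k)) (q : C).
    pose K : set C := [set Z | exists k, Z = j (a k)].
    have [_ [_ _ /(_ K [set (q : C)] y q)]] := jcan.
    case=> [||_ [k ->]|_ ->|||+ _]; first by exists (j (a 0)); exists 0.
    + by exists q.
    + exact/stone_closedE/stone_closed.
    + exact/stone_openE.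
    + apply/powerset_glb => W; split=> [Wy _ [k ->]|h k]; first exact: Wy.
      by apply: h; exists k.
    + by split=> [_ ->|z]; [exact: ale_refl|apply].
    case=> [|K0 [O0 [a0 [b0 [[fK0 _] _ [K0K O0q] [[_ glb] [_ lub]] ab0]]]]].
      exact/powerset_aleE.
    (* A finite part [K0] of the decreasing chain is bounded below by a single [j (a k)]. *)
    have [|m n _ _|Z KZ|k [_ kK0]] := finite_directed
      (D := fun=> True) (Q := fun k Z => ale (j (a k)) Z) fK0.
    + by exists 0.
    + exists (maxn m n); split=> // Z [|] le_Z; apply: (ale_trans bC _ le_Z);
      apply: hom_ale => //; apply: iter_boxdot_anti => //.
      - exact: leq_maxl.
      - exact: leq_maxr.
    + by have [k ->] := K0K Z KZ; exists k; split=> //; exact: ale_refl.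
    exists k; apply: (ale_trans bC (glb _ kK0)); apply: (ale_trans bC ab0).
    by apply: lub => _ /O0q ->; exact: ale_refl.
  exists (a k); split.
  + by move=> W /py; exact.
  + exact: (powerset_aleE (j (a k)) (q : C)).1 ak_q.
  (* One step further in the chain, [a k.+1] is [meet (box (a k)) (a k)], so [U] contains
     [box (a k)]. *)
  + by have /(ultra_meetE bA (svalP U))[] := yU k.+1.
- exact: (y_le 0).
- move=> z za; apply/powerset_aleE => U zU k.
  exact: (powerset_aleE (j z) (j (a k))).1 (hom_ale hj (za k)) U zU.
Qed.

End FixpointExtension.

(** * Terms, quotients and free algebras *)

Lemma hom_eval (A B : algebra) (X : Type) (f : A -> B) (v : X -> A) (t : term X) :
  homomorphism f -> f (eval v t) = eval (f \o v) t.
Proof.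
move=> hf; elim: t => //=.
- by move=> s IHs u IHu; rewrite hom_meet // IHs IHu.
- by move=> s IHs u IHu; rewrite hom_join // IHs IHu.
- by move=> s IHs; rewrite hom_neg // IHs.
- exact: hom_bot.
- exact: hom_top.
- by move=> s IHs; rewrite hom_box // IHs.
Qed.

Lemma eval_ext (A : algebra) (X : Type) (v w : X -> A) (t : term X) :
  (forall x, tvars t x -> v x = w x) -> eval v t = eval w t.
Proof.
elim: t => //=; first by move=> x; apply.
- by move=> s IHs u IHu vw; rewrite IHs ?IHu // => x ?; apply: vw; [right|left].
- by move=> s IHs u IHu vw; rewrite IHs ?IHu // => x ?; apply: vw; [right|left].
- by move=> s IHs vw; rewrite IHs.
- by move=> s IHs vw; rewrite IHs.
Qed.

Lemma eval_boxdot_term (A : algebra) (v : nat -> A) n :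
  eval v (boxdot_term n) = iter n (@boxdot A) (v 0).
Proof. by elim: n => //= n ->. Qed.

Lemma tvars_boxdot_term n : tvars (boxdot_term n) = [set 0].
Proof. by elim: n => //= n ->; rewrite setUid. Qed.

(* Evaluation in [term_algebra X] is substitution. *)
Definition term_algebra (X : Type) : algebra :=
  @Algebra (term X) (@TMeet X) (@TJoin X) (@TNeg X) TBot TTop (@TBox X).

Lemma eval_Var (X : Type) (t : term X) : eval (@Var X : X -> term_algebra X) t = t.
Proof. by elim: t => //= [s -> u ->|s -> u ->|s ->|s ->]. Qed.

Lemma eval_hom (A : algebra) (X : Type) (v : X -> A) :
  homomorphism (eval v : term_algebra X -> A).
Proof. by []. Qed.

Lemma hom_comp (A B C : algebra) (f : A -> B) (g : B -> C) :
  homomorphism f -> homomorphism g -> homomorphism (g \o f).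
Proof.
move=> [fM fJ fN f0 f1 fB] [gM gJ gN g0 g1 gB].
by split=> * /=; rewrite ?(fM, fJ, fN, f0, f1, fB).
Qed.

Lemma hom_can (A B : algebra) (f : A -> B) (g : B -> A) :
  homomorphism f -> cancel f g -> cancel g f -> homomorphism g.
Proof.
move=> hf fK gK; have fI := can_inj fK.
split=> [x y|x y|x|||x]; apply: fI;
  by rewrite ?(hom_meet hf, hom_join hf, hom_neg hf, hom_bot hf, hom_top hf,
               hom_box hf) !gK.
Qed.

Section QuotientTheory.
Variables (A : algebra) (R : A -> A -> Prop).
Hypothesis cR : congruence R.

Lemma quotient_class_eq (x y : A) :
  quotient_class R x = quotient_class R y <-> R x y.
Proof.
split=> [[->]|xy]; first exact: cong_refl.
apply: eq_exist; apply/funext => z; apply/propext.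
split=> h; last exact: cong_trans xy h.
exact: cong_trans (cong_sym cR xy) h.
Qed.

Lemma quotient_reprK (K : quotient R) : quotient_class R (quotient_repr K) = K.
Proof.
by case: K => K hK; apply: eq_exist; rewrite /quotient_repr /=; case: cid.
Qed.

Lemma quotient_hom : homomorphism (quotient_class R : A -> quotient R).
Proof.
have reprR x : R x (quotient_repr (quotient_class R x)).
  by apply/quotient_class_eq; rewrite quotient_reprK.
split=> // [x y|x y|x|x]; apply/quotient_class_eq.
- exact: cong_meet.
- exact: cong_join.
- exact: cong_neg.
- exact: cong_box.
Qed.

Lemma quotient_factor (B : algebra) (f : A -> B) :
  homomorphism f -> (forall x y, R x y -> f x = f y) ->
  exists g : quotient R -> B,
    homomorphism g /\ forall x, g (quotient_class R x) = f x.
Proof.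
move=> hf fR; pose g (K : quotient R) := f (quotient_repr K).
have gE x : g (quotient_class R x) = f x.
  by apply: fR; apply/quotient_class_eq; rewrite quotient_reprK.
have hq := quotient_hom.
exists g; split=> //; split.
- move=> K L; rewrite -[K]quotient_reprK -[L]quotient_reprK -(hom_meet hq).
  by rewrite !gE hom_meet.
- move=> K L; rewrite -[K]quotient_reprK -[L]quotient_reprK -(hom_join hq).
  by rewrite !gE hom_join.
- by move=> K; rewrite -[K]quotient_reprK -(hom_neg hq) !gE hom_neg.
- by rewrite -(hom_bot hq) gE hom_bot.
- by rewrite -(hom_top hq) gE hom_top.
- by move=> K; rewrite -[K]quotient_reprK -(hom_box hq) !gE hom_box.
Qed.

End QuotientTheory.

Lemma generated_congruenceP (A : algebra) (S : set (A * A)) :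
  congruence (generated_congruence S).
Proof.
split.
- by move=> x R cR _; exact: cong_refl.
- by move=> x y h R cR SR; apply: (cong_sym cR); exact: h.
- by move=> x y z h k R cR SR; apply: (cong_trans cR); [exact: h|exact: k].
- by move=> x x' y y' h k R cR SR; apply: (cong_meet cR); [exact: h|exact: k].
- by move=> x x' y y' h k R cR SR; apply: (cong_join cR); [exact: h|exact: k].
- by move=> x x' h R cR SR; apply: (cong_neg cR); exact: h.
- by move=> x x' h R cR SR; apply: (cong_box cR); exact: h.
Qed.

Lemma kernel_congruence (A B : algebra) (f : A -> B) :
  homomorphism f -> congruence (fun x y => f x = f y).
Proof.
move=> hf; split.
- by [].
- by [].
- by move=> x y z -> ->.
- by move=> x x' y y' xx yy; rewrite !hom_meet // xx yy.
- by move=> x x' y y' xx yy; rewrite !hom_join // xx yy.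
- by move=> x x' xx; rewrite !hom_neg // xx.
- by move=> x x' xx; rewrite !hom_box // xx.
Qed.

(** The kernel of [f] is a congruence containing [S], so it contains the generated one. *)
Lemma presentation_factor (A B : algebra) (S : set (A * A)) (f : A -> B) :
  homomorphism f -> (forall p, S p -> f p.1 = f p.2) ->
  exists g : quotient (generated_congruence S) -> B,
    homomorphism g /\ forall x, g (quotient_class _ x) = f x.
Proof.
move=> hf Sf; apply: quotient_factor => //; first exact: generated_congruenceP.
by move=> x y /(_ _ (kernel_congruence hf)); exact.
Qed.

Lemma subalgebra_val_hom (A : algebra) (S : set A) (hS : subuniverse S) :
  homomorphism (sval : subalgebra hS -> A).
Proof. by []. Qed.

Lemma generated_eval (A : algebra) (X : Type) (v : X -> A) (x : A) :
  generated (range v) x -> exists t : term X, x = eval v t.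
Proof.
move=> /(_ [set y | exists t : term X, y = eval v t]); apply; last first.
  by move=> _ [k _ <-]; exists (Var k).
split.
- by move=> _ _ [s ->] [t ->]; exists (TMeet s t).
- by move=> _ _ [s ->] [t ->]; exists (TJoin s t).
- by move=> _ [s ->]; exists (TNeg s).
- by exists TBot.
- by exists TTop.
- by move=> _ [s ->]; exists (TBox s).
Qed.

Section Varieties.
Variable V : algebra -> Prop.
Hypothesis V_variety : variety V.

(** Stated for an arbitrary [A], so that it covers quotients of members of [V] as well as quotients
    of term algebras. Valuations lift along representatives. *)
Lemma variety_quotient (A : algebra) (R : A -> A -> Prop) :
  congruence R ->
  (forall e, (forall B, V B -> valid B e) ->
     forall v : nat -> A, R (eval v e.1) (eval v e.2)) ->
  V (quotient R).
Proof.
have [E VE] := V_variety => cR RV; apply/VE => e Ee v.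
have hq := quotient_hom cR.
have -> : v = quotient_class R \o (quotient_repr (R:=R) \o v).
  by apply/funext => n /=; rewrite quotient_reprK.
rewrite /eq_holds -!(hom_eval _ _ hq); apply/(quotient_class_eq cR).
by apply: RV => B /VE; exact.
Qed.

Lemma variety_subalgebra (A : algebra) (S : set A) (hS : subuniverse S) :
  V A -> V (subalgebra hS).
Proof.
have [E VE] := V_variety => VA; apply/VE => e Ee v.
apply: eq_sig_hprop => [x|]; first exact: Prop_irrelevance.
have hv := subalgebra_val_hom hS.
by rewrite !(hom_eval _ _ hv); exact: (VE A).1 VA e Ee _.
Qed.

Section StageQuotient.
Variables (X : Type) (P : nat -> forall A : algebra, (X -> A) -> Prop).
Hypothesis P_anti : forall m n A v, (m <= n)%N -> V A -> P n v -> @P m A v.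

(* A directed union of congruences: stage [n] identifies the terms that agree
   under all valuations satisfying the [n]-th, increasingly strong, constraint. *)
Definition stage_eq (s t : term_algebra X) : Prop :=
  exists n, forall (A : algebra) (v : X -> A), V A -> P n v -> eval v s = eval v t.

Lemma stage_congruence : congruence stage_eq.
Proof.
(* Identifications made at stages [m] and [n] both hold at stage [maxn m n]. *)
have merge (s s' t t' : term X) : stage_eq s s' -> stage_eq t t' ->
    exists n, forall (A : algebra) (v : X -> A), V A -> P n v ->
      eval v s = eval v s' /\ eval v t = eval v t'.
  move=> [m hm] [n hn]; exists (maxn m n) => A v VA Pv.
  by split; [apply: hm|apply: hn] => //; apply: P_anti Pv => //;
    rewrite ?leq_maxl ?leq_maxr.
split.
- by move=> s; exists 0.
- by move=> s t [n h]; exists n => A v VA Pv; rewrite h.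
- move=> s t u st tu; have [n h] := merge _ _ _ _ st tu.
  by exists n => A v VA Pv; have [-> ->] := h A v VA Pv.
- move=> s s' t t' ss tt; have [n h] := merge _ _ _ _ ss tt.
  by exists n => A v VA Pv /=; have [-> ->] := h A v VA Pv.
- move=> s s' t t' ss tt; have [n h] := merge _ _ _ _ ss tt.
  by exists n => A v VA Pv /=; have [-> ->] := h A v VA Pv.
- by move=> s t [n h]; exists n => A v VA Pv /=; rewrite h.
- by move=> s t [n h]; exists n => A v VA Pv /=; rewrite h.
Qed.

Lemma stage_quotient_variety : V (quotient stage_eq).
Proof.
apply: variety_quotient; first exact: stage_congruence.
move=> e Ve v; exists 0 => A w VA _.
by rewrite !(hom_eval _ _ (eval_hom w)); exact: Ve.
Qed.

Definition stage_gen (x : X) : quotient stage_eq := quotient_class stage_eq (Var x).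

Lemma stage_eval (t : term X) : eval stage_gen t = quotient_class stage_eq t.
Proof.
by rewrite -[in RHS](eval_Var t) (hom_eval _ _ (quotient_hom stage_congruence)).
Qed.

Lemma stage_evalP (s t : term X) :
  eval stage_gen s = eval stage_gen t <-> stage_eq s t.
Proof. by rewrite !stage_eval; exact: (quotient_class_eq stage_congruence). Qed.

End StageQuotient.

Lemma free_algebra_exists (X : Type) :
  exists (F : algebra) (iota : X -> F), free_algebra V iota.
Proof.
(* Under a trivial constraint, [stage_eq P] is the equational theory of [V], and the quotient of the
   terms by it is free. *)
pose P (n : nat) (A : algebra) (v : X -> A) := True.
have aP m n A v : (m <= n)%N -> V A -> P n A v -> P m A v by [].
have cP := stage_congruence aP.
exists (quotient (stage_eq P)), (stage_gen P); split.
  exact: stage_quotient_variety.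
move=> B VB g.
have [|h [hh hE]] := quotient_factor cP (eval_hom g).
  by move=> s t [n]; apply.
exists h; split=> [|h' [hh' h'E]]; first by split=> // x; rewrite hE.
apply/funext => K; rewrite -[K]quotient_reprK -(stage_eval aP) !hom_eval //.
by congr eval; apply/funext => x /=; rewrite h'E hE.
Qed.

(** [iota] factors through the subalgebra generated by its range. By uniqueness the induced map
    followed by the inclusion is the identity, so that subalgebra is all of [F]. *)
Lemma free_algebra_eval (X : Type) (F : algebra) (iota : X -> F) (x : F) :
  free_algebra V iota -> exists t : term X, x = eval iota t.
Proof.
move=> [VF free]; apply: generated_eval.
pose hS := generated_subuniverse (range iota).
have Siota k : generated (range iota) (iota k).
  by move=> S _; apply; exists k.
pose g k : subalgebra hS := exist _ (iota k) (Siota k).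
have [h [[hh hE] _]] := free _ (variety_subalgebra hS VF) g.
have [u [_ uniq]] := free F VF iota.
have u_id : u = id by apply: uniq; split.
have : u = sval \o h.
  apply: uniq; split=> [|k /=]; last by rewrite hE.
  exact: hom_comp hh (subalgebra_val_hom hS).
by rewrite u_id => /(congr1 (@^~ x))/= ->; exact: svalP.
Qed.

End Varieties.

(** * Interpolation and coherence *)

(** All positive indices share the value [z], so that a stage quotient over the variables [nat] has
    only two distinct generators at most. *)
Definition pair_val (A : Type) (x z : A) (k : nat) : A := if k is 0 then x else z.

Definition chain_stage (n : nat) (A : algebra) (v : nat -> A) : Prop :=
  exists x z : A, v = pair_val x z /\ ale z (iter n (@boxdot A) x).

(** Variables 0, 1 and 2 stand for x, z and y. *)
Definition fixpoint_eqs : set equation :=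
  [set (TMeet (Var 1) (Var 2), Var 1); (TMeet (Var 2) (Var 0), Var 2);
       (TMeet (TBox (Var 2)) (Var 2), Var 2)].

Lemma fixpoint_eqsP (A : algebra) (v : nat -> A) :
  (forall e, fixpoint_eqs e -> eq_holds v e) <->
  [/\ ale (v 1) (v 2), ale (v 2) (v 0) & boxdot (v 2) = v 2].
Proof.
split=> [h|[zy yx yy] _ [[->|->]|->] //].
by split; [apply: (h (TMeet (Var 1) (Var 2), Var 1))
  |apply: (h (TMeet (Var 2) (Var 0), Var 2))
  |apply: (h (TMeet (TBox (Var 2)) (Var 2), Var 2))];
  rewrite /fixpoint_eqs /=; tauto.
Qed.

Section Chain.
Variable V : algebra -> Prop.
Hypotheses (V_variety : variety V)
  (V_modal : forall A : algebra, V A -> modal_algebra A)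
  (V_canonical : closed_under_canonical_extensions V).

(** z <= y = boxdot^n y <= boxdot^n x. *)
Lemma fixpoint_between (A : algebra) (x y z : A) n : V A ->
  ale z y -> ale y x -> boxdot y = y -> ale z (iter n (@boxdot A) x).
Proof.
move=> VA zy yx yy; have bA := modal_boolean (V_modal VA).
apply: (ale_trans bA zy); rewrite -(iter_boxdot_fix n yy).
exact: (iter_boxdot_mono V_modal).
Qed.

Lemma weakly_transitive_stage n :
  (forall (A : algebra) (x z : A), V A -> ale z (iter n (@boxdot A) x) ->
     ale z (iter n.+1 (@boxdot A) x)) ->
  weakly_transitive V.
Proof.
move=> h; exists n => A VA v; have bA := modal_boolean (V_modal VA).
rewrite /eq_holds /= -/(boxdot _) eval_boxdot_term; apply: ale_anti => //.
  exact: (boxdot_ale V_modal).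
by apply: h => //; exact: ale_refl.
Qed.

Lemma chain_stage_anti m n (A : algebra) (v : nat -> A) :
  (m <= n)%N -> V A -> chain_stage n v -> chain_stage m v.
Proof.
move=> mn VA [x [z [-> zx]]]; exists x, z; split=> //.
have bA := modal_boolean (V_modal VA).
exact: (ale_trans bA zx (iter_boxdot_anti V_modal _ VA mn)).
Qed.

(** The algebra presented in [V] by generators x, z and the infinitely many relations z <= boxdot^k
    x. *)
Definition chain_algebra : algebra := quotient (stage_eq V chain_stage).
Definition chain_gen : nat -> chain_algebra := stage_gen V chain_stage.

Lemma chain_algebra_variety : V chain_algebra.
Proof. exact: stage_quotient_variety chain_stage_anti. Qed.

Lemma chain_genE : chain_gen = pair_val (chain_gen 0) (chain_gen 1).
Proof.
apply/funext => -[//|k]; apply/(stage_evalP chain_stage_anti (Var k.+1) (Var 1)).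
by exists 0 => A v VA [x [z [-> _]]].
Qed.

Lemma chain_extension :
  exists (C : algebra) (j : chain_algebra -> C) (y : C),
    [/\ V C, homomorphism j, injective j &
      [/\ ale (j (chain_gen 1)) y, ale y (j (chain_gen 0)) & boxdot y = y]].
Proof.
have [C [j [y [VC hj jI [yy yx zy]]]]] :=
  fixpoint_extension V_modal (chain_gen 0) V_canonical chain_algebra_variety.
exists C, j, y; split=> //; split=> //; apply: zy => k.
have := (stage_evalP chain_stage_anti
  (TMeet (Var 1) (boxdot_term k)) (Var 1)).2.
rewrite /= eval_boxdot_term; apply.
by exists k => A v VA [x [z [-> zx]]] /=; rewrite eval_boxdot_term.
Qed.

(** The compactness step: each equation true of the generators is already forced at a finite stage,
    and finitely many stages have a maximum. *)
Lemma chain_uniform_stage (S : set equation) :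
  finite_set S -> (forall e, S e -> eq_holds chain_gen e) ->
  exists n, forall (A : algebra) (x z : A), V A ->
    ale z (iter n (@boxdot A) x) -> forall e, S e -> eq_holds (pair_val x z) e.
Proof.
move=> fS hS.
have [|m n _ _|e Se|n [_ h]] := finite_directed (D := fun=> True)
  (Q := fun n e => forall (A : algebra) (x z : A), V A ->
    ale z (iter n (@boxdot A) x) -> eq_holds (pair_val x z) e) fS.
- by exists 0.
- exists (maxn m n); split=> // e [h|h] A x z VA zx; apply: h => //;
    have bA := modal_boolean (V_modal VA); apply: (ale_trans bA zx);
    by apply: (iter_boxdot_anti V_modal) => //; rewrite ?leq_maxl ?leq_maxr.
- have [n h] := (stage_evalP chain_stage_anti _ _).1 (hS e Se).
  by exists n; split=> // A x z VA zx; apply: h => //; exists x, z.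
- by exists n => A x z VA zx e Se; exact: h.
Qed.

(** The equations of an interpolant [P] follow from [fixpoint_eqs], so they hold of [chain_gen],
    hence from some stage [n] on. But [P] entails z <= boxdot^(n+1) x. *)
Lemma not_right_uniform_deductive_interpolation :
  right_uniform_deductive_interpolation V -> weakly_transitive V.
Proof.
move=> /(_ [set 2] [set 0; 1] fixpoint_eqs).
have [C [j [y [VC hj jI [zy yx yy]]]]] := chain_extension.
case=> [||||e|P [fP Pvars Pe]].
- exact: finite_set1.
- exact: finite_set2.
- by apply/seteqP; split=> k //= [-> []].
- exact: finite_set3.
- by case=> [[->|->]|->] k; rewrite /eq_vars /=; tauto.
have {}Pe e : eq_vars e `<=` [set 0; 1] ->
    consequence V fixpoint_eqs e <-> consequence V P e.
  by move=> ve; apply: (Pe set0); rewrite ?set0I ?setU0.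
have [e Pe'|n hn] := chain_uniform_stage fP.
  (* Agrees with [j \o chain_gen] on the shared variables 0 and 1, and interprets variable 2 by the
     fixpoint. *)
  pose w k := if k is 2 then y else j (chain_gen k).
  have ev t : tvars t `<=` [set 0; 1] -> eval w t = j (eval chain_gen t).
    move=> vt; rewrite hom_eval //; apply: eval_ext => k /vt.
    by case=> ->.
  have : eq_holds w e.
    apply: ((Pe e (Pvars e Pe')).2 _ C VC w); last exact/fixpoint_eqsP.
    by move=> A VA v; apply.
  rewrite /eq_holds !ev; first exact: jI.
  - by move=> k ?; apply: Pvars Pe' _ _; right.
  - by move=> k ?; apply: Pvars Pe' _ _; left.
apply: (@weakly_transitive_stage n) => A x z VA zx.
have [|SP _] := Pe (TMeet (Var 1) (boxdot_term n.+1), Var 1).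
  by move=> k; rewrite /eq_vars /= tvars_boxdot_term /=; tauto.
have := SP _ A VA _ (hn A x z VA zx).
rewrite /eq_holds /= -/(boxdot _) eval_boxdot_term; apply.
move=> B VB v /fixpoint_eqsP[zy' yx' yy'].
rewrite /eq_holds /= -/(boxdot _) eval_boxdot_term.
exact: (fixpoint_between n.+1 VB zy' yx' yy').
Qed.

(** Let [A] be presented by [fixpoint_eqs] and [B] be its subalgebra generated by x, z. A finite
    presentation of [B], rewritten in x and z, holds of [chain_gen], hence from some stage [N] on.
    So any x, z with z <= boxdot^N x in a member of [V] are images of the generators of [B], which
    satisfy z <= boxdot^(N+1) x because [A] contains y. *)
Lemma not_coherent : coherent V -> weakly_transitive V.
Proof.
move=> coh.
have [F3 [iota3 [VF3 free3]]] := free_algebra_exists V_variety 'I_3.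
(* [inord] sends indices from 3 on to 0; [fixpoint_eqs] uses only 0, 1 and 2. *)
pose g k := iota3 (inord k).
pose S3 : set (F3 * F3) := (fun e => (eval g e.1, eval g e.2)) @` fixpoint_eqs.
pose A := quotient (generated_congruence S3).
have cA := generated_congruenceP S3.
have hA := quotient_hom cA.
have VA : V A.
  apply: variety_quotient => // e Ve v.
  by rewrite [eval v e.1](Ve F3 VF3 v); exact: cong_refl.
have fpA : finitely_presented V A.
  exists 3, F3, iota3, S3; split=> //; first exact: finite_image (finite_set3 _ _ _).
  by exists id; split=> //; exists id.
pose a k : A := quotient_class _ (g k).
have [zy yx yy] : [/\ ale (a 1) (a 2), ale (a 2) (a 0) & boxdot (a 2) = a 2].
  apply/fixpoint_eqsP => e Se; rewrite /eq_holds -!(hom_eval _ _ hA).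
  by apply/(quotient_class_eq cA) => R cR SR; apply: (SR (_, _)); exists e.
pose G : set A := [set a 0; a 1].
have [n [F [iota [S [freeF fS [f [hf [f' fK f'K]]]]]]]] :=
  coh A VA fpA G (finite_set2 _ _).
pose B := generated_subalgebra G.
have hf' := hom_can hf fK f'K.
have cF := generated_congruenceP S.
have hF := quotient_hom cF.
have valh : homomorphism (sval : B -> A) := subalgebra_val_hom _.
have /choice[t tE] : forall i : 'I_n, exists t : term nat,
    sval (f' (quotient_class _ (iota i))) = eval (pair_val (a 0) (a 1)) t.
  move=> i; apply: generated_eval => T hT rT.
  apply: (svalP (f' _) T hT) => _ [->|->]; apply: rT; [by exists 0|by exists 1].
have [s sE] := choice (fun x : F => free_algebra_eval V_variety x freeF).
(* Writes an element of [F] as a term in its generators, then replaces each generator by its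
   expression [t i] in x and z. *)
pose tm (x : F) : term nat := eval (t : _ -> term_algebra nat) (s x).
have tmE (D : algebra) (w : nat -> D) x :
    eval w (tm x) = eval (fun i => eval w (t i)) (s x).
  by rewrite /tm (hom_eval _ _ (eval_hom w)).
have G0 : generated G (a 0) by move=> T _; apply; left.
have G1 : generated G (a 1) by move=> T _; apply; right.
pose bx : B := exist _ (a 0) G0; pose bz : B := exist _ (a 1) G1.
pose px := quotient_repr (f bx); pose pz := quotient_repr (f bz).
(* The relations of [B] rewritten in x and z, together with the expressions of x and z through the
   generators of the presentation. *)
pose eqs : set equation := (fun u => (tm u.1, tm u.2)) @` S `|`
  [set (tm px, Var 0); (tm pz, Var 1)].
have [||N hN] := @chain_uniform_stage eqs.
- by rewrite finite_setU; split; [exact: finite_image|exact: finite_set2].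
- have [C [j [y [VC hj jI [zy' yx' yy']]]]] := chain_extension.
  (* Sending the third generator to [y] yields a homomorphism [phi] from [A] to [C] that agrees with
     [j] on x and z; injectivity of [j] then brings equations back to [chain_algebra]. *)
  pose w k := match k with 0 => j (chain_gen 0) | 1 => j (chain_gen 1) | _ => y end.
  have [phi0 [[hphi0 phi0E] _]] := free3 C VC (fun i => w i).
  have phi0g k : k < 3 -> phi0 (g k) = w k by move=> k3; rewrite phi0E inordK.
  have [|phi [hphi phiE]] := presentation_factor (S := S3) hphi0.
    move=> _ [e Se <-] /=; rewrite !hom_eval //.
    apply: (fixpoint_eqsP (phi0 \o g)).2 Se.
    by rewrite /= !phi0g.
  have phi_gen : phi \o pair_val (a 0) (a 1) = j \o chain_gen.
    by rewrite chain_genE; apply/funext => -[|k] /=; rewrite phiE phi0g.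
  have phi_tm x : phi (sval (f' (quotient_class _ x))) = j (eval chain_gen (tm x)).
    have hpsi := hom_comp (hom_comp (hom_comp hF hf') valh) hphi.
    rewrite [in LHS](sE x) (hom_eval _ _ hj) tmE.
    rewrite [LHS](hom_eval _ _ hpsi); congr eval; apply/funext => i /=.
    by rewrite tE (hom_eval _ _ hphi) phi_gen.
  move=> e [[u Su <-]|[->|->]]; apply: jI; rewrite -phi_tm.
  + rewrite -phi_tm; congr (phi (sval (f' _))).
    by apply/(quotient_class_eq cF) => R cR; exact.
  + by rewrite quotient_reprK fK phiE phi0g.
  + by rewrite quotient_reprK fK phiE phi0g.
apply: (@weakly_transitive_stage N) => D x z VD /(hN D x z VD) hw.
have [h0 [[hh0 h0E] _]] := freeF.2 D VD (fun i => eval (pair_val x z) (t i)).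
have h0tm u : h0 u = eval (pair_val x z) (tm u).
  rewrite tmE [in LHS](sE u) hom_eval //; congr eval.
  by apply/funext => i /=.
(* The translated relations give a homomorphism from the presentation of [B] to [D]; the last two
   equations of [eqs] make it send [f bx] to [x] and [f bz] to [z]. *)
have [|h1 [hh1 h1E]] := presentation_factor (S := S) hh0.
  by move=> u Su; rewrite !h0tm; apply: (hw (_, _)); left; exists u.
have hh := hom_comp hf hh1.
have hx : h1 (f bx) = x.
  rewrite -(quotient_reprK (f bx)) h1E h0tm.
  by apply: (hw (_, Var 0)); right; left.
have hz : h1 (f bz) = z.
  rewrite -(quotient_reprK (f bz)) h1E h0tm.
  by apply: (hw (_, Var 1)); right; right.
rewrite -{1}hz -hx -(hom_iter_boxdot _ _ hh); apply: (hom_ale hh).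
have vI : injective (sval : B -> A) by move=> u v; exact: eq_sig_hprop.
(* The inequality in [B] is checked in [A], where [a 2] lies in between. *)
apply: (inj_hom_ale valh vI); rewrite (hom_iter_boxdot _ _ valh).
exact: (fixpoint_between N.+1 VA zy yx yy).
Qed.

End Chain.

(** * Ultraproducts and model completions *)

Section Ultraproduct.
Variable M : nat -> algebra.

Definition product_algebra : algebra :=
  @Algebra (forall n, M n) (fun f g n => meet (f n) (g n))
    (fun f g n => join (f n) (g n)) (fun f n => neg (f n)) (fun=> bot)
    (fun=> top) (fun f n => box (f n)).

Lemma product_proj_hom n :
  homomorphism (fun f : product_algebra => f n).
Proof. by []. Qed.

Variable U : (nat -> Prop) -> Prop.
Hypothesis uU : ultrafilter (U : powerset_algebra (X := nat) id -> Prop).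
Let fU := ultra_filter uU.
Let bN := powerset_boolean (X := nat) id.

Let U_and (P Q : nat -> Prop) : U (fun n => P n /\ Q n) <-> U P /\ U Q.
Proof. exact: (ultra_meetE bN uU). Qed.

Let U_or (P Q : nat -> Prop) : U (fun n => P n \/ Q n) <-> U P \/ U Q.
Proof. exact: (ultra_joinE bN uU). Qed.

Let U_not (P : nat -> Prop) : U (fun n => ~ P n) <-> ~ U P.
Proof. exact: (ultra_negE bN uU). Qed.

Let U_up (P Q : nat -> Prop) : (forall n, P n -> Q n) -> U P -> U Q.
Proof. by move=> PQ; apply: (filter_up fU); exact/powerset_aleE. Qed.

Let U_all (P : nat -> Prop) : (forall n, P n) -> U P.
Proof. by move=> PT; apply: U_up (filter_top fU) => n _. Qed.

Let U_imp (P Q : nat -> Prop) : U (fun n => P n -> Q n) <-> (U P -> U Q).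
Proof.
split=> [UPQ UP|UPQ].
  by apply: U_up ((U_and _ _).2 (conj UPQ UP)) => n [PQ]; exact: PQ.
by have [/UPQ|/U_not] := pselect (U P); apply: U_up.
Qed.

Let U_ex (P : forall n, M n -> Prop) :
  U (fun n => exists x, P n x) <->
  exists f : product_algebra, U (fun n => P n (f n)).
Proof.
split=> [UP|[f]]; last by apply: U_up => n Pf; exists (f n).
(* Factors without a witness receive [bot]. *)
have w n : exists x, (exists y, P n y) -> P n x.
  by have [[x Px]|nP] := pselect (exists y, P n y); [exists x|exists bot].
exists (fun n => projT1 (cid (w n))).
by apply: U_up UP => n; exact: (projT2 (cid (w n))).
Qed.

Let U_forall (P : forall n, M n -> Prop) :
  U (fun n => forall x, P n x) <->
  forall f : product_algebra, U (fun n => P n (f n)).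
Proof.
split=> [UP f|UP]; first by apply: U_up UP => n; exact.
apply: contrapT => /U_not nUP.
have [|f Uf] := (U_ex (fun n x => ~ P n x)).1.
  by apply: U_up nUP => n /existsNP.
by have /U_not := Uf; apply; exact: UP.
Qed.

Definition ultra_eq (f g : product_algebra) : Prop := U (fun n => f n = g n).

Lemma ultra_eq_congruence : congruence ultra_eq.
Proof.
have U2 (P Q T : nat -> Prop) : (forall n, P n -> Q n -> T n) -> U P -> U Q -> U T.
  by move=> PQT UP UQ; apply: U_up ((U_and _ _).2 (conj UP UQ)) => n []; exact: PQT.
split.
- by move=> f; exact: U_all.
- by move=> f g; apply: U_up => n ->.
- by move=> f g h; apply: U2 => n -> ->.
- by move=> f f' g g'; apply: U2 => n /= -> ->.
- by move=> f f' g g'; apply: U2 => n /= -> ->.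
- by move=> f f'; apply: U_up => n /= ->.
- by move=> f f'; apply: U_up => n /= ->.
Qed.

Definition ultraproduct : algebra := quotient ultra_eq.
Definition ultra_class (f : product_algebra) : ultraproduct := quotient_class _ f.

(** Łoś's theorem, with valuations given by representatives in the product. *)
Lemma ultraproduct_holds (f : formula void) (v : nat -> product_algebra) :
  holds (of_void ultraproduct) (ultra_class \o v) f <->
  U (fun n => holds (of_void (M n)) (fun k => v k n) f).
Proof.
have hq := quotient_hom ultra_eq_congruence.
have updE (w : nat -> product_algebra) k a :
    upd (ultra_class \o w) k (ultra_class a) = ultra_class \o upd w k a.
  by apply/funext => i; rewrite /upd /=; case: eqP.
have updnE (w : nat -> product_algebra) k a n :
    (fun i => upd w k a i n) = upd (fun i => w i n) k (a n).
  by apply/funext => i; rewrite /upd; case: eqP.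
elim: f v => [t s|g IHg|g IHg h IHh|g IHg h IHh|g IHg h IHh|k g IHg|k g IHg] v.
- pose w (x : void + nat) : product_algebra :=
    match x with inl k => of_void _ k | inr k => v k end.
  have evE (r : term (void + nat)) : eval (fun x => match x with
      inl k => of_void ultraproduct k | inr k => (ultra_class \o v) k end) r =
      ultra_class (eval w r).
    by rewrite /ultra_class (hom_eval _ _ hq); congr eval; apply/funext => -[[]|].
  have evn (r : term (void + nat)) n : eval w r n = eval (fun x => match x with
      inl k => of_void (M n) k | inr k => v k n end) r.
    rewrite (hom_eval w r (product_proj_hom n)); congr eval.
    by apply/funext => -[[]|].
  rewrite /= !evE; apply: (iff_trans (quotient_class_eq ultra_eq_congruence _ _)).
  by split; apply: U_up => n; rewrite !evn.
- by rewrite /= IHg -U_not.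
- by rewrite /= IHg IHh -U_and.
- by rewrite /= IHg IHh -U_or.
- by rewrite /= IHg IHh -U_imp.
- rewrite /= U_forall; split=> [h a|h K].
    by have := h (ultra_class a); rewrite updE IHg; apply: U_up => n; rewrite updnE.
  rewrite -[K]quotient_reprK updE IHg.
  by apply: U_up (h (quotient_repr K)) => n; rewrite updnE.
- rewrite /= U_ex; split=> [[K h]|[a h]].
    exists (quotient_repr K); move: h.
    by rewrite -{1}[K]quotient_reprK updE IHg; apply: U_up => n; rewrite updnE.
  exists (ultra_class a); rewrite updE IHg.
  by apply: U_up h => n; rewrite updnE.
Qed.

Lemma ultraproduct_model (T : set (formula void)) :
  (forall n, model (of_void (M n)) T) -> model (of_void ultraproduct) T.
Proof.
move=> MT f Tf v.
have -> : v = ultra_class \o (@quotient_repr _ ultra_eq \o v).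
  by apply/funext => k /=; rewrite /ultra_class quotient_reprK.
by apply/ultraproduct_holds/U_all => n; exact: MT.
Qed.

End Ultraproduct.

(** An extension of the Fréchet filter of cofinite sets. *)
Lemma free_ultrafilter_nat : exists U : (nat -> Prop) -> Prop,
  ultrafilter (U : powerset_algebra (X := nat) id -> Prop) /\
  forall m, U (fun n => (m <= n)%N).
Proof.
pose F (P : powerset_algebra (X := nat) id) := exists m, forall n, (m <= n)%N -> P n.
have [||U [uU FU]] := @ultrafilter_extension _ F; first exact: powerset_boolean.
  split.
  - by exists 0.
  - move=> P Q [m hP] [k hQ]; exists (maxn m k) => n; rewrite geq_max.
    by move=> /andP[/hP ? /hQ].
  - by move=> P Q /powerset_aleE PQ [m hP]; exists m => n /hP/PQ.
  - by move=> [m /(_ m (leqnn m))].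
by exists U; split=> // m; apply: FU; exists m.
Qed.

(** * First-order theories, diagrams and embeddings *)

Fixpoint universal_closure (m : nat) (f : formula void) : formula void :=
  if m is k.+1 then FAll k (universal_closure k f) else f.

Lemma universal_closure_free_vars m (f : formula void) :
  free_vars (universal_closure m f) = free_vars f `\` [set k | (k < m)%N].
Proof.
elim: m => [|m /= ->].
  by apply/seteqP; split=> [k fk|k []].
apply/seteqP; split=> k /=.
  move=> [[fk km] nkm]; split=> //; rewrite ltnS leq_eqVlt => /orP[/eqP|].
    exact: nkm.
  exact: km.
move=> [fk km]; split=> [|km']; last by apply: km; rewrite km'.
by split=> // lt_km; apply: km; rewrite ltnS ltnW.
Qed.

Lemma universal_closure_satisfies (A : algebra) m (f : formula void) :
  satisfies (of_void A) (universal_closure m f) <-> satisfies (of_void A) f.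
Proof.
elim: m => //= m <-; split=> [h v|h v a]; last exact: h.
suff -> : v = upd v m (v m) by exact: h.
by apply/funext => k; rewrite /upd; case: eqP => // ->.
Qed.

Lemma tvars_bound (C : Type) (t : term (C + nat)) :
  exists m, forall k, tvars t (inr k) -> (k < m)%N.
Proof.
have merge (s u : term (C + nat)) :
    (exists m, forall k, tvars s (inr k) -> (k < m)%N) ->
    (exists m, forall k, tvars u (inr k) -> (k < m)%N) ->
    exists m, forall k, (tvars s `|` tvars u) (inr k) -> (k < m)%N.
  move=> [m hm] [n hn]; exists (maxn m n) => k; rewrite leq_max.
  by move=> [/hm ->|/hn ->] //; rewrite orbT.
elim: t => //=.
- by case=> [c|n]; [exists 0|exists n.+1 => k [->]].
- by move=> s IHs u IHu; exact: merge.
- by move=> s IHs u IHu; exact: merge.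
- by exists 0.
- by exists 0.
Qed.

Definition equation_formula (e : equation) : formula void :=
  let emb : term nat -> term (void + nat) :=
    eval (A := term_algebra (void + nat)) (fun k => Var (inr k)) in
  FEq (emb e.1) (emb e.2).

Lemma equation_formulaP (A : algebra) (e : equation) (v : nat -> A) :
  holds (of_void A) v (equation_formula e) <-> eq_holds v e.
Proof. by rewrite /= !(hom_eval _ _ (eval_hom _)). Qed.

(** The universal closures of the defining equations are sentences of the theory. *)
Lemma model_first_order_theory (V : algebra -> Prop) (A : algebra) : variety V ->
  model (of_void A) (first_order_theory V) <-> V A.
Proof.
move=> [E VE]; split=> [AT|VA f [_ fV]]; last exact: fV.
apply/VE => e Ee v; apply/equation_formulaP; move: v.
have [m1 b1] := tvars_bound (if equation_formula e is FEq s _ then s else TBot).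
have [m2 b2] := tvars_bound (if equation_formula e is FEq _ s then s else TBot).
apply/(universal_closure_satisfies A (maxn m1 m2))/AT; split.
  rewrite /sentence universal_closure_free_vars; apply/seteqP; split=> // k [].
  by move=> [/b1 km|/b2 km] []; rewrite /= leq_max km ?orbT.
move=> B /VE VB; apply/universal_closure_satisfies => v.
by apply/equation_formulaP; exact: VB.
Qed.

Lemma holds_lift (A : algebra) (C : Type) (c : C -> A) (f : formula void) v :
  holds c v (lift_formula C f) <-> holds (of_void A) v f.
Proof.
have lift_eval w t : eval (fun x => match x with inl k => c k | inr n => w n end)
    (lift_term C t) =
    eval (fun x => match x with inl k => of_void A k | inr n => w n end) t.
  elim: t => //=; first by case=> [[]|].
  - by move=> s -> u ->.
  - by move=> s -> u ->.
  - by move=> s ->.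
  - by move=> s ->.
elim: f v => [t s|g IHg|g IHg h IHh|g IHg h IHh|g IHg h IHh|k g IHg|k g IHg] v /=.
- by rewrite !lift_eval.
- by rewrite IHg.
- by rewrite IHg IHh.
- by rewrite IHg IHh.
- by rewrite IHg IHh.
- by split=> h a; apply/IHg.
- by split=> -[a h]; exists a; apply/IHg.
Qed.

(** Agreement is asked on free variables only, so that sentences transfer between unrelated
    valuations. *)
Lemma embedding_holds (A B : algebra) (C : Type) (c : C -> A) (j : A -> B)
    (f : formula C) (v : nat -> A) (w : nat -> B) :
  homomorphism j -> injective j -> quantifier_free f ->
  (forall n, free_vars f n -> w n = j (v n)) ->
  holds (j \o c) w f <-> holds c v f.
Proof.
move=> hj jI; elim: f => //= [t s|g IHg|g IHg h IHh|g IHg h IHh|g IHg h IHh].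
- move=> _ vw.
  have ev r : tvars r `<=` tvars t `|` tvars s ->
      eval (fun x => match x with inl k => (j \o c) k | inr n => w n end) r =
      j (eval (fun x => match x with inl k => c k | inr n => v n end) r).
    move=> rts; rewrite hom_eval //; apply: eval_ext => -[//|n] /rts.
    exact: vw.
  by rewrite !ev; [split=> [/jI|->]|right|left].
- by move=> qg vw; rewrite IHg.
- by move=> [qg qh] vw; rewrite IHg ?IHh // => n ?; apply: vw; [right|left].
- by move=> [qg qh] vw; rewrite IHg ?IHh // => n ?; apply: vw; [right|left].
- by move=> [qg qh] vw; rewrite IHg ?IHh // => n ?; apply: vw; [right|left].
Qed.

(** Used with the identity, for [M] itself, and with an embedding of [M] into a larger model of
    [T]. *)
Lemma embedding_model_diagram (M N : algebra) (j : M -> N) (T : set (formula void)) :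
  homomorphism j -> injective j -> model (of_void N) T ->
  model j (lift_formula M @` T `|` @qf_diagram M).
Proof.
move=> hj jI NT f [[g Tg <-]|[sf qf Mf]] w; first by apply/holds_lift; exact: NT.
apply/(@embedding_holds _ _ _ id j f (fun=> bot) w) => //.
by rewrite sf.
Qed.

Definition fixpoint_formula (C : Type) (x z : C) : formula C :=
  let y := Var (inr 0) in
  FEx 0 (FAnd (FEq (TMeet (Var (inl z)) y) (Var (inl z)))
    (FAnd (FEq (TMeet y (Var (inl x))) y) (FEq (TMeet (TBox y) y) y))).

Lemma fixpoint_formula_sentence (C : Type) (x z : C) :
  sentence (fixpoint_formula x z).
Proof.
apply/seteqP; split=> // k []; rewrite /setU /= => h nk; apply: nk.
by intuition congruence.
Qed.

Lemma fixpoint_formulaP (A : algebra) (C : Type) (c : C -> A) (x z : C) v :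
  holds c v (fixpoint_formula x z) <->
  exists y : A, [/\ ale (c z) y, ale y (c x) & boxdot y = y].
Proof. by split=> [[y [zy [yx yy]]]|[y [zy yx yy]]]; exists y. Qed.

(** * Model completions *)

Section ModelCompletion.
Variable V : algebra -> Prop.
Hypotheses (V_variety : variety V)
  (V_modal : forall A : algebra, V A -> modal_algebra A)
  (V_canonical : closed_under_canonical_extensions V).

Lemma not_has_model_completion :
  has_model_completion (first_order_theory V) -> weakly_transitive V.
Proof.
move=> [T [_ VT emb compl]]; apply: contrapT => nwt.
have modV (A : algebra) : model (of_void A) (first_order_theory V) <-> V A.
  exact: model_first_order_theory.
have TV (A : algebra) : model (of_void A) T -> V A.
  by move=> AT; apply/modV => f /VT; exact: AT.
(* A failure at stage [n] in a member of [V] moves into a model of [T], since embeddings preserve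
   and reflect the order. *)
have stages n : exists p : {N : algebra & (N * N)%type},
    let: existT N (x, z) := p in
    [/\ model (of_void N) T, ale z (iter n (@boxdot N) x) &
        ~ ale z (iter n.+1 (@boxdot N) x)].
  apply: contrapT => noN; apply: nwt; apply: (@weakly_transitive_stage V V_modal n).
  move=> A x z VA zx; apply: contrapT => nzx; apply: noN.
  have [N [NT [j [hj jI]]]] := emb A ((modV A).2 VA).
  exists (existT _ N (j x, j z)); split=> //.
    by rewrite -hom_iter_boxdot //; exact: hom_ale.
  by rewrite -hom_iter_boxdot // => /(inj_hom_ale hj jI).
pose N n : algebra := projT1 (projT1 (cid (stages n))).
pose x n : N n := (projT2 (projT1 (cid (stages n)))).1.
pose z n : N n := (projT2 (projT1 (cid (stages n)))).2.
have [NT zx nzx] : [/\ forall n, model (of_void (N n)) T,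
    forall n, ale (z n) (iter n (@boxdot (N n)) (x n)) &
    forall n, ~ ale (z n) (iter n.+1 (@boxdot (N n)) (x n))].
  by split=> n; rewrite /N /x /z; case: (cid (stages n)) => -[A [u w]] [].
have [U [uU Ucof]] := free_ultrafilter_nat.
have fU := ultra_filter uU.
have cU := ultra_eq_congruence N uU.
pose M := ultraproduct N U.
have hM : homomorphism (ultra_class U : product_algebra N -> M) := quotient_hom cU.
have MT : model (of_void M) T by exact: ultraproduct_model.
have VM := TV _ MT.
pose mx : M := ultra_class U x; pose mz : M := ultra_class U z.
have mzx k : ale mz (iter k (@boxdot M) mx).
  rewrite -(hom_iter_boxdot _ _ hM) /ale -(hom_meet hM).
  (* The relation with exponent [k] holds in every factor of index at least [k]. *)
  apply/(quotient_class_eq cU); apply: (filter_up fU) (Ucof k).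
  apply/powerset_aleE => n kn /=.
  rewrite (hom_iter_boxdot k (x : product_algebra N) (product_proj_hom N n)).
  have VN := TV _ (NT n).
  apply: (ale_trans (modal_boolean (V_modal VN)) (zx n)).
  exact: (iter_boxdot_anti V_modal).
have no_y : ~ exists y : M, [/\ ale mz y, ale y mx & boxdot y = y].
  move=> [K [zK Kx KK]]; move: zK Kx KK.
  rewrite -[K]quotient_reprK -/(ultra_class U _); set y := quotient_repr K.
  rewrite /ale /boxdot -(hom_box hM) -!(hom_meet hM).
  move=> /(quotient_class_eq cU) Uzy /(quotient_class_eq cU) Uyx.
  move=> /(quotient_class_eq cU) Uyy; apply: (filter_bot fU).
  (* The three relations for y hold together on a set in [U]; at any index in it they contradict
     [nzx]. *)
  apply: (filter_up fU) (filter_meet fU (filter_meet fU Uzy Uyx) Uyy).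
  apply/powerset_aleE => n [[zy yx] yy]; apply: (nzx n).
  exact: (fixpoint_between V_modal n.+1 (TV _ (NT n)) zy yx yy).
have [C [j [y [VC hj jI [yy yx zy]]]]] :=
  fixpoint_extension V_modal mx V_canonical VM.
have [N' [N'T [k [hk kI]]]] := emb C ((modV C).2 VC).
(* The sentence is false in [M] by [no_y], but true in [N'], where [k y] is a witness. *)
have [E|E] := compl M ((modV M).2 VM) _ (fixpoint_formula_sentence mx mz).
  have idM : model (@id M) (lift_formula M @` T `|` @qf_diagram M).
    exact: embedding_model_diagram.
  exact: no_y ((fixpoint_formulaP _ _ _ _).1 (E _ _ idM (fun=> bot))).
have kjM : model (k \o j) (lift_formula M @` T `|` @qf_diagram M).
  by apply: embedding_model_diagram => //; [exact: hom_comp|exact: inj_comp].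
apply: (E _ _ kjM (fun=> bot)); apply/fixpoint_formulaP; exists (k y); split.
- exact: (hom_ale hk (zy _ mzx)).
- exact: (hom_ale hk yx).
- by rewrite -[in RHS]yy /boxdot (hom_meet hk) (hom_box hk).
Qed.

End ModelCompletion.

Theorem corollary5p4 (V : algebra -> Prop)
    (V_variety : variety V)
    (V_modal : forall A : algebra, V A -> modal_algebra A)
    (V_canonical : closed_under_canonical_extensions V)
    (V_not_wtrans : ~ weakly_transitive V) :
  ~ coherent V /\
  ~ right_uniform_deductive_interpolation V /\
  ~ has_model_completion (first_order_theory V).
Proof.
split; last split; move=> h; apply: V_not_wtrans.
- exact: not_coherent.
- exact: not_right_uniform_deductive_interpolation.
- exact: not_has_model_completion.
Qed.
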